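(* Let $A=\Bbbk[x_1,\ldots,x_n,y]$ be a polynomial ring over a field $\Bbbk$, with $\mathbb{N}^2$-grading $\deg x_i=(1,0)$ for all $i$ and $\deg y=(0,1)$. Let $\mathfrak{a}$ be a multigraded $A$-ideal (homogeneous for this $\mathbb{N}^2$-grading) with $\mathfrak{a}_1=0$, $R=A/\mathfrak{a}$, let $B=A[z]$ with $z$ an indeterminate, let $d\ge 1$ be an integer, and let $p^A_{y,d,z}:A\to A[z]$ be the polarization map. If $\mathcal{H}_R$ admits an embedding, then $\mathcal{H}_{B/(p^A_{y,d,z}(\mathfrak{a}))}$ admits an embedding.
   Context: $\mathbb{N}$ is the set of non-negative integers. For a standard graded $\Bbbk$-algebra $R=\bigoplus_{d\ge0}R_d$ ($R_0=\Bbbk$, $R=\Bbbk[R_1]$, $\dim_\Bbbk R_1<\infty$), $\mathcal{I}_R$ is the set of homogeneous ideals of $R$ (in the standard grading), partially ordered by inclusion; $H_I(\mathfrak{z})=\sum_{t\in\mathbb{N}}(\dim_\Bbbk I_t)\mathfrak{z}^t\in\mathbb{Z}[[\mathfrak{z}]]$ is the Hilbert series of $I\in\mathcal{I}_R$; $\mathcal{H}_R=\{H_J: J\in\mathcal{I}_R\}$, partially ordered coefficientwise. $\mathcal{H}_R$ admits an embedding (into $\mathcal{I}_R$) if there is an order-preserving injective map $\epsilon:\mathcal{H}_R\to\mathcal{I}_R$ with $H_{\epsilon(H)}=H$ for all $H\in\mathcal{H}_R$. Subscript $1$ in $\mathfrak a_1$ refers to the standard grading of $A$; $B$ and its quotient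 are standard graded with $\deg z=1$. The polarization $p^A_{y,d,z}:A\to A[z]$ is the $\Bbbk$-linear map such that for all homogeneous forms $f\in A$ not involving $y$ and all $i\in\mathbb{N}$, $fy^i\mapsto fy^i$ if $i<d$, and $fy^i\mapsto fy^{i-1}z$ if $i\ge d$. $(p^A_{y,d,z}(\mathfrak{a}))$ is the ideal of $B$ generated by the image of $\mathfrak{a}$. *)

(* Defs.v *)
From HB Require Import structures.
From mathcomp Require Import all_boot all_algebra.
From mathcomp Require Import boolp classical_sets.
From mathcomp Require Import ssrcomplements mpoly zify.

Set Implicit Arguments.
Unset Strict Implicit.
Unset Printing Implicit Defensive.

Import GRing.Theory.
Local Open Scope ring_scope.
Local Open Scope quotient_scope.
Local Open Scope classical_set_scope.

(* Unlike [idealr] of ring_quotient, an [ideal] may be the whole ring.  By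
   [asbool] every subset is given by a boolean predicate, so that these are
   all the ideals, not only those with decidable membership. *)
HB.mixin Record isMulStable (R : pzRingType) (S : R -> bool) := {
  mul_stable_subproof : forall a, {in S, forall u, a * u \in S}
}.

#[short(type="ideal")]
HB.structure Definition Ideal (R : pzRingType) :=
  {S of GRing.ZmodClosed R S & isMulStable R S}.

Lemma ideal_mull (R : pzRingType) (I : ideal R) a u : u \in I -> a * u \in I.
Proof. exact: mul_stable_subproof. Qed.

Section GeneratedIdeal.
Variables (R : comPzRingType) (S : set R).

Definition ideal_gen : {pred R} := fun f =>
  `[< exists2 s : seq (R * R), (forall u, u \in s -> S u.2) &
        f = \sum_(u <- s) u.1 * u.2 >].

Lemma ideal_genP f : reflect
  (exists2 s : seq (R * R), (forall u, u \in s -> S u.2) &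
     f = \sum_(u <- s) u.1 * u.2)
  (f \in ideal_gen).
Proof. exact: asboolP. Qed.

Lemma ideal_gen_mull a : {in ideal_gen, forall f, a * f \in ideal_gen}.
Proof.
move=> f /ideal_genP[s Ss ->]; apply/ideal_genP.
exists [seq (a * u.1, u.2) | u <- s].
  by move=> _ /mapP[u us ->]; exact: Ss us.
by rewrite big_map mulr_sumr; apply: eq_bigr => u _; rewrite mulrA.
Qed.

Lemma ideal_gen_zmod_closed : zmod_closed ideal_gen.
Proof.
split=> [|f g fI gI]; first by apply/ideal_genP; exists [::]; rewrite ?big_nil.
move/(ideal_gen_mull (- 1)): gI; rewrite mulN1r => /ideal_genP[t St ->].
case/ideal_genP: fI => s Ss ->; apply/ideal_genP; exists (s ++ t).
  by move=> u; rewrite mem_cat => /orP[]; [exact: Ss | exact: St].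
by rewrite big_cat.
Qed.

HB.instance Definition _ := GRing.isZmodClosed.Build R ideal_gen
  ideal_gen_zmod_closed.
HB.instance Definition _ := isMulStable.Build R ideal_gen ideal_gen_mull.

End GeneratedIdeal.

(* The ring {ideal_quot I} of ring_quotient requires I to be proper (and so has
   a nonzero quotient) and carries no scalar action; [quotalg] is the quotient
   by any ideal, as a commutative ring and a k-module. *)
Definition quotalg (k : pzRingType) (A : comAlgType k) (I : ideal A) : Type :=
  {ideal_quot I}.

Section QuotientAlgebra.
Variables (k : pzRingType) (A : comAlgType k) (I : ideal A).
Local Notation Q := (quotalg I).

HB.instance Definition _ := GRing.Zmodule.on Q.
HB.instance Definition _ := EqQuotient.on Q.

Lemma quotalg_eqE (x y : A) : (\pi_Q x == \pi_Q y) = (x - y \in I).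
Proof. by rewrite -Quotient.equivE piE. Qed.

Lemma quotalg_piD (x y : A) : \pi_Q (x + y) = \pi_Q x + \pi_Q y.
Proof. exact: (raddfD (\pi_{ideal_quot I})). Qed.

Definition quotalg_one : Q := lift_cst Q 1.
Definition quotalg_mul := lift_op2 Q *%R.
Definition quotalg_scale (c : k) := lift_op1 Q ( *:%R c).

Lemma repr_pi_mod (x : A) : repr (\pi_Q x) - x \in I.
Proof. by rewrite -quotalg_eqE reprK. Qed.

Lemma ideal_scale c (x : A) : x \in I -> c *: x \in I.
Proof. by move=> xI; rewrite -mulr_algl ideal_mull. Qed.

Lemma quotalg_mul_pi (x y : A) : quotalg_mul (\pi_Q x) (\pi_Q y) = \pi_Q (x * y).
Proof.
unlock quotalg_mul; apply/eqP; rewrite quotalg_eqE.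
have -> : repr (\pi_Q x) * repr (\pi_Q y) - x * y =
    repr (\pi_Q x) * (repr (\pi_Q y) - y) + y * (repr (\pi_Q x) - x).
  by rewrite !mulrBr [y * repr (\pi x)]mulrC addrA subrK [y * x]mulrC.
by rewrite rpredD // ideal_mull // repr_pi_mod.
Qed.

Lemma quotalg_scale_pi c (x : A) : quotalg_scale c (\pi_Q x) = \pi_Q (c *: x).
Proof.
unlock quotalg_scale; apply/eqP.
by rewrite quotalg_eqE -scalerBr ideal_scale // repr_pi_mod.
Qed.

Lemma quotalg_mulA : associative quotalg_mul.
Proof. by move=> x y z;
  rewrite -[x]reprK -[y]reprK -[z]reprK !quotalg_mul_pi mulrA. Qed.

Lemma quotalg_mulC : commutative quotalg_mul.
Proof. by move=> x y; rewrite -[x]reprK -[y]reprK !quotalg_mul_pi mulrC. Qed.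

Lemma quotalg_mul1 : left_id quotalg_one quotalg_mul.
Proof.
move=> x; rewrite -[x]reprK.
have -> : quotalg_one = \pi_Q 1 by unlock quotalg_one.
by rewrite quotalg_mul_pi mul1r.
Qed.

Lemma quotalg_mulDl : left_distributive quotalg_mul +%R.
Proof. by move=> x y z;
  rewrite -[x]reprK -[y]reprK -[z]reprK -quotalg_piD !quotalg_mul_pi mulrDl quotalg_piD. Qed.

HB.instance Definition _ := GRing.Zmodule_isComPzRing.Build Q
  quotalg_mulA quotalg_mulC quotalg_mul1 quotalg_mulDl.

Lemma quotalg_scaleA a b x :
  quotalg_scale a (quotalg_scale b x) = quotalg_scale (a * b) x.
Proof. by rewrite -[x]reprK !quotalg_scale_pi scalerA. Qed.

Lemma quotalg_scale1 : left_id 1 quotalg_scale.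
Proof. by move=> x; rewrite -[x]reprK quotalg_scale_pi scale1r. Qed.

Lemma quotalg_scaleDr : right_distributive quotalg_scale +%R.
Proof. by move=> c x y;
  rewrite -[x]reprK -[y]reprK -quotalg_piD !quotalg_scale_pi scalerDr quotalg_piD. Qed.

Lemma quotalg_scaleDl x : {morph quotalg_scale^~ x : a b / a + b}.
Proof. by move=> a b;
  rewrite -[x]reprK !quotalg_scale_pi scalerDl quotalg_piD. Qed.

HB.instance Definition _ := GRing.Zmodule_isLmodule.Build k Q
  quotalg_scaleA quotalg_scale1 quotalg_scaleDr quotalg_scaleDl.

Lemma quotalg_scaleAl (c : k) (x y : Q) : c *: (x * y) = (c *: x) * y.
Proof.
rewrite -[x]reprK -[y]reprK.
rewrite /GRing.mul /GRing.scale /=.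
by rewrite quotalg_mul_pi !quotalg_scale_pi quotalg_mul_pi scalerAl.
Qed.

Lemma quotalg_piM (x y : A) : \pi_Q (x * y) = \pi_Q x * \pi_Q y.
Proof. by rewrite -quotalg_mul_pi. Qed.

Lemma quotalg_piZ c (x : A) : \pi_Q (c *: x) = c *: \pi_Q x.
Proof. by rewrite -quotalg_scale_pi. Qed.

End QuotientAlgebra.

Section Dimension.
Variables (k : fieldType) (W : lmodType k).

Definition is_basis (V : set W) (m : nat) (b : 'I_m -> W) : Prop :=
  (forall v, V v <-> exists c : 'I_m -> k, v = \sum_i c i *: b i) /\
  (forall c : 'I_m -> k, \sum_i c i *: b i = 0 -> forall i, c i = 0).

(* The default value 0 is only taken when V has no finite basis. *)
Definition dim (V : set W) : nat :=
  xget 0%N [set m | exists b : 'I_m -> W, is_basis V b].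

Lemma basis_size_le (V : set W) m1 m2 (b1 : 'I_m1 -> W) (b2 : 'I_m2 -> W) :
  is_basis V b1 -> is_basis V b2 -> (m1 <= m2)%N.
Proof.
move=> [V1 free1] [V2 _].
have memb1 i : V (b1 i).
  apply/V1; exists (fun j => (j == i)%:R).
  rewrite (bigD1 i) //= eqxx scale1r big1 ?addr0 // => j /negbTE ->.
  exact: scale0r.
have /choice[C Cb] : forall i, exists c : 'I_m2 -> k, b1 i = \sum_j c j *: b2 j.
  by move=> i; apply/V2.
pose M : 'M[k]_(m1, m2) := \matrix_(i, j) C i j.
suff /eqP <- : row_free M by exact: rank_leq_col.
rewrite -kermx_eq0; apply/rowV0P => u /sub_kermxP uM0.
apply/rowP => i; rewrite mxE; apply: (free1 (fun i => u 0 i)).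
under eq_bigr do rewrite Cb scaler_sumr.
rewrite exchange_big big1 // => j _.
under eq_bigr do rewrite scalerA.
rewrite -scaler_suml; suff -> : \sum_i u 0 i * C i j = 0 by rewrite scale0r.
have := congr1 (fun v : 'rV_m2 => v 0 j) uM0; rewrite !mxE => uMj.
by rewrite -[RHS]uMj; apply: eq_bigr => l _; rewrite mxE.
Qed.

Lemma dim_basis (V : set W) m (b : 'I_m -> W) : is_basis V b -> dim V = m.
Proof.
move=> Vb; have: [set m' | exists b' : 'I_m' -> W, is_basis V b'] (dim V).
  by apply: (@xgetPex _ 0%N [set m' | exists b' : 'I_m' -> W, is_basis V b']);
    exists m, b.
case=> b' Vb'; apply/eqP; rewrite eqn_leq.
by rewrite (basis_size_le Vb' Vb) (basis_size_le Vb Vb').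
Qed.

End Dimension.

(* [gr] is the family of homogeneous components of R, indexed by the degrees;
   [homogeneous J] says that J is the sum of the J :&: gr t. *)
Section Graded.
Variables (R : pzRingType) (T : Type) (gr : T -> set R).

Definition component (J : {pred R}) (t : T) : set R :=
  [set x | x \in J /\ gr t x].

Definition homogeneous (J : {pred R}) : Prop :=
  forall x, x \in J -> exists2 s : seq R,
    x = \sum_(y <- s) y & forall y, y \in s -> exists t, component J t y.

End Graded.

(* Coefficient sequences of elements of Z[[z]], ordered coefficientwise. *)
Definition int_series := nat -> int.

Definition le_series (F G : int_series) : Prop := forall t, (F t <= G t)%R.

Definition std_grading (k : fieldType) (n : nat) (t : nat) :
    set {mpoly k[n]} :=
  [set f | f \is t.-homog].

Definition quot_grading (k : fieldType) (n : nat) (I : ideal {mpoly k[n]})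
    (t : nat) : set (quotalg I) :=
  \pi_(quotalg I) @` std_grading t.

(* R = k[x_1, ..., x_n] / I, for I homogeneous in the standard grading. *)
Section HilbertSeries.
Variables (k : fieldType) (n : nat) (I : ideal {mpoly k[n]}).
Local Notation R := (quotalg I).
Local Notation gr := (@quot_grading k n I).

Definition hilbert_series (J : ideal R) : int_series :=
  fun t => (dim (component gr J t))%:Z.

Definition hilbert_set : set int_series :=
  [set hilbert_series J | J in [set J : ideal R | homogeneous gr J]].

(* An embedding is a map on [hilbert_set]; its values elsewhere are junk. *)
Definition is_embedding (eps : int_series -> ideal R) : Prop :=
  [/\ forall F, hilbert_set F -> homogeneous gr (eps F),
      forall F G, hilbert_set F -> hilbert_set G ->
        le_series F G -> {subset eps F <= eps G},
      forall F G, hilbert_set F -> hilbert_set G ->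
        eps F =i eps G -> F = G
    & forall F, hilbert_set F -> hilbert_series (eps F) = F].

Definition quot_admits_embedding : Prop := exists eps, is_embedding eps.

End HilbertSeries.

(* In {mpoly k[n.+1]} the last variable plays the role of y and the first n
   that of the x_i; {mpoly k[n.+2]} is A[z], with A embedded by [mwiden] and z
   the last variable. *)
Section Polarization.
Variables (k : fieldType) (n : nat).
Local Notation A := {mpoly k[n.+1]}.
Local Notation B := {mpoly k[n.+2]}.
Local Notation y := (@ord_max n).
Local Notation z := (@ord_max n.+1).

Definition bigrading (uv : nat * nat) : set A :=
  [set f | forall m, m \in msupp f ->
     (\sum_(i < n) m (widen_ord (leqnSn n) i))%N = uv.1 /\ m y = uv.2].

Definition polarize_mnm (d : nat) (m : 'X_{1..n.+1}) : 'X_{1..n.+2} :=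
  if (m y < d)%N then mnmwiden m else (mnmwiden (m - U_(y)) + U_(z))%MM.

Definition polarize (d : nat) (f : A) : B :=
  \sum_(m <- msupp f) f@_m *: 'X_[polarize_mnm d m].

Lemma polarizewE d b (f : A) : (msize f <= b)%N ->
  polarize d f = \sum_(m : 'X_{1..n.+1 < b}) f@_m *: 'X_[polarize_mnm d m].
Proof.
move=> fb; rewrite /polarize; pose I : subFinType _ := 'X_{1..n.+1 < b}.
rewrite (big_mksub I) //=; first last.
- by move=> m /msize_mdeg_lt /leq_trans; apply.
- by rewrite msupp_uniq.
by rewrite big_rmcond //= => m /memN_msupp_eq0 ->; rewrite scale0r.
Qed.

Lemma polarize_is_linear d : linear (polarize d).
Proof.
move=> c f g; pose b := maxn (msize (c *: f + g)) (maxn (msize f) (msize g)).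
rewrite !(@polarizewE d b) ?leq_max ?leqnn ?orbT //.
rewrite scaler_sumr -big_split /=; apply: eq_bigr => m _.
by rewrite mcoeffD mcoeffZ scalerDl scalerA.
Qed.

HB.instance Definition _ d := GRing.isLinear.Build k A B _ (polarize d)
  (polarize_is_linear d).

Lemma polarizeX d m : polarize d 'X_[m] = 'X_[polarize_mnm d m].
Proof. by rewrite /polarize msuppX big_seq1 mcoeffX eqxx scale1r. Qed.

(* On the products f y^i that define the polarization. *)
Lemma polarize_mulXy d (f : A) i :
  (forall m, m \in msupp f -> m y = 0%N) -> (0 < d)%N ->
  polarize d (f * 'X_y ^+ i) =
    if (i < d)%N then mwiden (f * 'X_y ^+ i)
    else mwiden (f * 'X_y ^+ i.-1) * 'X_z.
Proof.
move=> fy d_gt0.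
have fE j : f * 'X_y ^+ j = \sum_(m <- msupp f) f@_m *: 'X_[m] * 'X_y ^+ j.
  by rewrite {1}[f]mpolyE mulr_suml.
have widen_sum (F : 'X_{1..n.+1} -> A) :
    mwiden (\sum_(m <- msupp f) F m) = \sum_(m <- msupp f) mwiden (F m).
  exact: raddf_sum.
have polE m : m \in msupp f -> polarize d (f@_m *: 'X_[m] * 'X_y ^+ i) =
    if (i < d)%N then mwiden (f@_m *: 'X_[m] * 'X_y ^+ i)
    else mwiden (f@_m *: 'X_[m] * 'X_y ^+ i.-1) * 'X_z.
  move=> /fy my; rewrite -!scalerAl linearZ /= !mpolyXn -!mpolyXD polarizeX.
  have -> : polarize_mnm d (m + U_(y) *+ i)%MM = if (i < d)%N
      then mnmwiden (m + U_(y) *+ i)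
      else (mnmwiden (m + U_(y) *+ i.-1) + U_(z))%MM.
    rewrite /polarize_mnm mnmDE mulmnE mnm1E eqxx mul1n my add0n.
    case: ltnP => // di; congr (mnmwiden _ + _)%MM.
    by apply/mnmP => j; rewrite mnmBE !mnmDE !mulmnE mnm1E;
      case: eqP => [<-|_]; lia.
  by case: ifP => _; rewrite mwidenZ mwidenX // -scalerAl mpolyXD.
rewrite {1}fE linear_sum /= (eq_big_seq _ polE) !fE !widen_sum.
by case: ifP => _ //; rewrite [RHS]mulr_suml.
Qed.

Definition polarized_ideal (d : nat) (a : ideal A) : ideal B :=
  ideal_gen (polarize d @` [set` a]).

End Polarization.

(* Main.v *)
From HB Require Import structures.
From mathcomp Require Import all_boot all_algebra.
From mathcomp Require Import boolp classical_sets functions.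
From mathcomp Require Import mpoly zify.
Require Import Defs.

Set Implicit Arguments.
Unset Strict Implicit.
Unset Printing Implicit Defensive.

Import GRing.Theory.
Local Open Scope ring_scope.
Local Open Scope quotient_scope.
Local Open Scope classical_set_scope.

(** Write A = k[x, y], R = A/a, l = y - z and P = B/p(a), where p is the
    polarization.

    An embedding for a standard graded algebra is the same thing as a choice,
    in every degree t, of a chain of subspaces L t 0, L t 1, ... of the degree
    t part, with dim L t h = h, such that L t h generates in degree t + 1 a
    member of the chain, of the least dimension that any h-dimensional subspace
    can generate: these chains behave like the lexicographic segments of a
    polynomial ring ([segments_of_embedding], [embedding_of_segments]).  The
    point is that the degree t part of the ideal attached to a Hilbert function
    H depends on H(t) only, because it can be computed after enlarging the
    ideal to everything in degrees above t and truncating it below t.  So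
    segments have to be transported from R to P.

    The map p is a section of the projection z |-> y from B to A, whose kernel
    is generated by l.  Hence B is the direct sum of the l^i p(A), and as a is
    bihomogeneous P is the direct sum of the l^i p(R): an element of P is a
    sequence of elements of R ([coef], [coef_mem], [mem_coef]).  In these terms
    the x_j and l act as on R[l], while y acts as y + l delta, where delta is
    the projection of R onto the part of degree d - 1 in y ([polarizeMy]).  One
    can first replace the segments of R by their initial spaces for the degree
    in y, and so assume that delta preserves them ([segments_leading]).

    In degree t the segments of P are the direct sums of the
    l^i p(L (t - i) (v i)), where the sequence v of sum h is the greedy one: it
    has the least possible v 0 among the sequences that are stable, in the
    sense that L (t - i - 1) (v (i + 1)) generates at most v i dimensions.
    The growth of this direct sum is h plus the growth of L t (v 0)
    ([greedy_growth]).  It remains to see that every h-dimensional subspace V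
    of P grows at least as much ([growth_bound]).  Passing from V to the spaces
    U i of initial coefficients for the order in l replaces V by a graded
    subspace of R[l] and does not increase growth.  The U i need not be stable.
    As long as some x does not map U (i + 1) into U i, the linear change of
    basis l^i |-> (l - x) l^(i - 1), followed by another passage to initial
    spaces, moves dimension towards small powers of l and again does not
    increase growth ([stabilisation]); this substitution, unlike l |-> l - x,
    involves no binomial coefficients and works in every characteristic.  For
    stable U the growth is h plus the growth of U 0, and dim U 0 is at least
    the first entry of the greedy sequence ([top_least]). *)

(** * Subspaces of finite dimension *)

Section Subspaces.
Variable k : fieldType.

Definition subspace (W : lmodType k) (V : set W) : Prop :=
  V 0 /\ forall c u v, V u -> V v -> V (c *: u + v).

Definition findim (W : lmodType k) (V : set W) : Prop :=
  exists m (b : 'I_m -> W), is_basis V b.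

Section Closure.
Variables (W : lmodType k) (V : set W).
Hypothesis sV : subspace V.

Lemma subspace0 : V 0. Proof. by case: sV. Qed.

Lemma subspaceD u v : V u -> V v -> V (u + v).
Proof. by move=> Vu Vv; rewrite -[u]scale1r; apply: sV.2. Qed.

Lemma subspaceZ c u : V u -> V (c *: u).
Proof. by move=> Vu; rewrite -[_ *: _]addr0; apply: sV.2 => //; apply: sV.1. Qed.

Lemma subspaceB u v : V u -> V v -> V (u - v).
Proof. by move=> Vu Vv; rewrite -scaleN1r; apply/subspaceD/subspaceZ. Qed.

Lemma subspace_sum (I : Type) (s : seq I) (P : pred I) (F : I -> W) :
  (forall i, P i -> V (F i)) -> V (\sum_(i <- s | P i) F i).
Proof.
move=> VF; elim/big_rec: _ => [|i u Pi Vu]; first exact: subspace0.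
by apply: subspaceD => //; exact: VF.
Qed.

End Closure.

(** Among the matrices with rows in [V], one of maximal rank spans [V], since
    otherwise a vector of [V] could be added to its row space. *)
Lemma subspace_matrix m (V : set 'rV[k]_m) : subspace V ->
  exists M : 'M[k]_m, forall c, V c <-> (c <= M)%MS.
Proof.
move=> sV.
pose P r := `[< exists M : 'M[k]_m, \rank M = r /\
                forall c : 'rV_m, (c <= M)%MS -> V c >].
have P0 : exists r, P r.
  exists 0%N; apply/asboolP; exists 0; split; first exact: mxrank0.
  by move=> c; rewrite submx0 => /eqP ->; case: sV.
have Pm r : P r -> (r <= m)%N.
  by move=> /asboolP[M [<- _]]; exact: rank_leq_row.
case: (ex_maxnP P0 Pm) => r /asboolP[M [rM VM]] maxr.
exists M => c; split=> [Vc|]; last exact: VM.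
have /maxr : P (\rank (M + c)%MS).
  apply/asboolP; exists (M + c)%MS; split=> // u /sub_addsmxP[[u1 u2] ->] /=.
  apply: subspaceD => //; first by apply: VM; exact: submxMl.
  by rewrite [u2]mx11_scalar mul_scalar_mx; exact: subspaceZ.
rewrite -rM => le_rank.
have := mxrank_leqif_sup (addsmxSl M c).
rewrite /leqif => -[le1 eq1]; move: eq1.
rewrite eqn_leq le1 le_rank /= => /esym.
by rewrite addsmx_sub => /andP[].
Qed.

Lemma rowspace_basis (W : lmodType k) m (g : {linear 'rV[k]_m -> W})
    (M : 'M[k]_m) :
  (forall c, (c <= M)%MS -> g c = 0 -> c = 0) ->
  is_basis (g @` [set c | (c <= M)%MS])
    (fun i : 'I_(\rank M) => g (row i (row_base M))).
Proof.
move=> ginj.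
have gE (c : 'I_(\rank M) -> k) : \sum_i c i *: g (row i (row_base M)) =
    g ((\row_i c i) *m row_base M).
  rewrite mulmx_sum_row linear_sum; apply: eq_bigr => i _.
  by rewrite mxE linearZ.
split=> [v|c].
  split=> [[c]|[c ->]].
    rewrite /= -(eq_row_base M) => /submxP[D ->] <-.
    exists (fun i => D 0 i); rewrite gE; congr (g (_ *m _)).
    by apply/rowP => i; rewrite mxE.
  rewrite gE; exists ((\row_i c i) *m row_base M) => //=.
  by rewrite -(eq_row_base M) submxMl.
rewrite gE => /ginj c0 i.
have /(row_free_inj (row_base_free M)) : (\row_i c i) *m row_base M = 0 *m row_base M.
  by rewrite mul0mx; apply: c0; rewrite -(eq_row_base M) submxMl.
by move=> /rowP/(_ i); rewrite !mxE.
Qed.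

(** A complement of the kernel maps isomorphically onto the range. *)
Lemma findim_image (W : lmodType k) m (g : {linear 'rV[k]_m -> W}) :
  findim (range g).
Proof.
have sK : subspace [set c | g c = 0].
  split=> [|c u v]; first exact: linear0.
  by rewrite /= => gu gv; rewrite linearP gu gv scaler0 addr0.
have [K KP] := subspace_matrix sK.
exists (\rank K^C%MS), (fun i => g (row i (row_base K^C%MS))).
suff -> : range g = g @` [set c | (c <= K^C)%MS].
  apply: rowspace_basis => c cC /KP cK; apply/eqP; rewrite -submx0.
  by rewrite -(capmx_compl K) sub_capmx cK cC.
apply/seteqP; split=> _ [c _ <-]; last by exists c.
have : (c <= K + K^C)%MS.
  by apply: submx_full; rewrite addsmx_compl_full.
move=> /sub_addsmxP[[u1 u2] /= ->].
exists (u2 *m K^C)%MS; first exact: submxMl.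
by rewrite linearD [g (u1 *m K)](KP _).2 ?add0r //; exact: submxMl.
Qed.

Section Dim.
Variable W : lmodType k.
Implicit Types U V : set W.

Lemma basis_subspace V m (b : 'I_m -> W) : is_basis V b -> subspace V.
Proof.
move=> [Vb _]; split=> [|c u v].
  by apply/Vb; exists (fun=> 0); rewrite big1 // => i _; rewrite scale0r.
move=> /Vb[x ->] /Vb[y ->]; apply/Vb; exists (fun i => c * x i + y i).
rewrite scaler_sumr -big_split; apply: eq_bigr => i _ /=.
by rewrite scalerDl scalerA.
Qed.

Lemma findim_subspace V : findim V -> subspace V.
Proof. by move=> [m [b /basis_subspace]]. Qed.

Lemma findim_coord V : findim V -> exists m (g : {linear 'rV[k]_m -> W}),
  [/\ injective g, range g = V & dim V = m].
Proof.
move=> [m [b Vbasis]]; have [Vb freeb] := Vbasis.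
pose g (c : 'rV[k]_m) := \sum_i c 0 i *: b i.
have glin : linear g.
  move=> c u v; rewrite /g scaler_sumr -big_split; apply: eq_bigr => i _ /=.
  by rewrite !mxE scalerDl scalerA.
pose gL := GRing.isLinear.Build _ _ _ _ g glin.
exists m, (HB.pack_for {linear 'rV[k]_m -> W} g gL).
split=> /=; last exact: dim_basis Vbasis.
  move=> u v uv; apply/rowP => i; apply/eqP; rewrite -subr_eq0; apply/eqP.
  have -> : u 0 i - v 0 i = (u - v) 0 i by rewrite !mxE.
  apply: (freeb (fun i => (u - v) 0 i)).
  rewrite -[RHS](subrr (g v)) -{1}uv /g -sumrB; apply: eq_bigr => j _.
  by rewrite !mxE scalerBl.
apply/seteqP; split=> [_ [c _ <-]|v /Vb[c ->]].
  by apply/Vb; exists (fun i => c 0 i).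
by exists (\row_i c i) => //; apply: eq_bigr => i _; rewrite mxE.
Qed.

Lemma findim_sub U V : findim V -> subspace U -> U `<=` V ->
  [/\ findim U, (dim U <= dim V)%N & dim U = dim V -> U = V].
Proof.
move=> fV sU UV; have [m [g [ginj gV ->]]] := findim_coord fV.
have sC : subspace [set c | U (g c)].
  split=> [|c u v]; first by rewrite /= linear0; case: sU.
  by rewrite /= => gu gv; rewrite linearP; apply: sU.2.
have [M MP] := subspace_matrix sC.
have UE : U = g @` [set c | (c <= M)%MS].
  apply/seteqP; split=> [u Uu|_ [c /MP cM <-]] //.
  have := UV _ Uu; rewrite -gV => -[c _ gc].
  by exists c => //; apply/MP; rewrite /= gc.
have Ub : is_basis U (fun i : 'I_(\rank M) => g (row i (row_base M))).
  rewrite UE; apply: rowspace_basis => c _ gc; apply: ginj.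
  by rewrite gc linear0.
rewrite (dim_basis Ub); split=> [||full]; first by exists (\rank M); eexists; exact: Ub.
  exact: rank_leq_col.
rewrite UE -gV; apply/seteqP; split=> _ [c _ <-]; exists c => //=.
by apply: submx_full; rewrite /row_full full.
Qed.

Lemma dim_sub U V : findim V -> subspace U -> U `<=` V -> (dim U <= dim V)%N.
Proof. by move=> fV sU UV; case: (findim_sub fV sU UV). Qed.

Lemma dim_sub_eq U V : findim V -> subspace U -> U `<=` V ->
  (dim V <= dim U)%N -> U = V.
Proof.
move=> fV sU UV le; case: (findim_sub fV sU UV) => _ le' -> //.
by apply/eqP; rewrite eqn_leq le' le.
Qed.

Lemma subspace_zero : subspace [set 0 : W].
Proof. by split=> // c u v /= -> ->; rewrite scaler0 addr0. Qed.

Lemma zero_basis : is_basis [set 0 : W] (fun i : 'I_0 => 0).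
Proof.
split=> [v|c _ []//]; split=> [->|[c ->]]; last by rewrite /= big_ord0.
by exists (fun=> 0); rewrite big_ord0.
Qed.

Lemma findim0 : findim [set 0 : W].
Proof. by exists 0%N, (fun=> 0); exact: zero_basis. Qed.

Lemma dim0 : dim [set 0 : W] = 0%N.
Proof. exact: dim_basis zero_basis. Qed.

Lemma exists_subspace V h : findim V -> (h <= dim V)%N ->
  exists U, [/\ findim U, U `<=` V & dim U = h].
Proof.
move=> /findim_coord[m [g [ginj <- ->]]] le.
have := @rowspace_basis W _ g (pid_mx h).
case=> [c _ gc|Ub Ufree]; first by apply: ginj; rewrite gc linear0.
have Uh : dim (g @` [set c | (c <= (pid_mx h : 'M_m))%MS]) = h.
  by rewrite (dim_basis (conj Ub Ufree)) rank_pid_mx.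
eexists; split; last exact: Uh; first by eexists; eexists; split; [exact: Ub|].
by move=> _ [c _ <-]; exists c.
Qed.

End Dim.

Lemma rank_nullity (W W' : lmodType k) (f : {linear W -> W'}) (V : set W) :
  findim V ->
  [/\ findim (f @` V), findim [set v | V v /\ f v = 0] &
     dim V = (dim [set v | V v /\ f v = 0%R] + dim (f @` V))%N].
Proof.
move=> /findim_coord[m [g [ginj gV ->]]].
have sK : subspace [set c | f (g c) = 0].
  split=> [|c u v]; first by rewrite /= !linear0.
  by rewrite /= => gu gv; rewrite !linearP gu gv scaler0 addr0.
have [K KP] := subspace_matrix sK.
have kerE : [set v | V v /\ f v = 0] = g @` [set c | (c <= K)%MS].
  apply/seteqP; split=> [v|_ [c /KP fc <-]]; last by split=> //; rewrite -gV; exists c.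
  by move=> [] /=; rewrite -gV => -[c _ <-] fc; exists c => //; apply/KP.
have imE : f @` V = (f \o g) @` [set c | (c <= K^C)%MS].
  rewrite -gV; apply/seteqP; split=> [_ [_ [c _ <-] <-]|_ [c _ <-]] /=; last first.
    by exists (g c) => //; exists c.
  have : (c <= K + K^C)%MS by apply: submx_full; rewrite addsmx_compl_full.
  move=> /sub_addsmxP[[u1 u2] /= ->].
  exists (u2 *m K^C%MS); first exact: submxMl.
  by rewrite /= !linearD [f (g (u1 *m K))](KP _).2 ?add0r //; exact: submxMl.
have ginjK c : (c <= K)%MS -> g c = 0 -> c = 0.
  by move=> _ gc; apply: ginj; rewrite gc linear0.
have ginjC c : (c <= K^C)%MS -> (f \o g) c = 0 -> c = 0.
  move=> cC /KP cK; apply/eqP; rewrite -submx0.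
  by rewrite -(capmx_compl K) sub_capmx cK cC.
have kerb := rowspace_basis ginjK; have imb := rowspace_basis ginjC.
rewrite -kerE in kerb; rewrite -imE in imb.
rewrite (dim_basis kerb) (dim_basis imb) mxrank_compl subnKC ?rank_leq_col //.
by split=> //; eexists; eexists; [exact: imb | exact: kerb].
Qed.

(** Lifts of a basis of the image, with a basis of the kernel, span [V]. *)
Lemma findim_extension (W W' : lmodType k) (f : {linear W -> W'}) (V : set W) :
  subspace V -> findim (f @` V) -> findim [set v | V v /\ f v = 0] -> findim V.
Proof.
move=> sV [q [b [Vb _]]] /findim_coord[p [g [_ gV _]]].
have /choice[w wP] : forall j, exists v, V v /\ f v = b j.
  move=> j; suff [v Vv fv] : (f @` V) (b j) by exists v.
  apply/Vb; exists (fun i => (i == j)%:R).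
  rewrite (bigD1 j) //= eqxx scale1r big1 ?addr0 // => i /negbTE ->.
  exact: scale0r.
pose h (c : 'rV[k]_(p + q)) := g (lsubmx c) + \sum_j rsubmx c 0 j *: w j.
have hlin : linear h.
  move=> c u v; rewrite /h !linearP scalerDr addrACA; congr (_ + _).
  rewrite scaler_sumr -big_split; apply: eq_bigr => i _ /=.
  by rewrite !mxE scalerDl scalerA.
pose hL := GRing.isLinear.Build _ _ _ _ h hlin.
suff <- : range (HB.pack_for {linear 'rV[k]_(p + q) -> W} h hL) = V.
  exact: findim_image.
apply/seteqP; split=> [_ [c _ <-]|v Vv] /=.
  apply: subspaceD => //.
    have : range g (g (lsubmx c)) by exists (lsubmx c).
    by rewrite gV => -[].
  by apply: subspace_sum => // j _; apply: subspaceZ => //; case: (wP j).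
have : (f @` V) (f v) by exists v.
move=> /Vb[c fvE].
have : [set v | V v /\ f v = 0] (v - \sum_j c j *: w j).
  split=> /=.
    apply: subspaceB => //; apply: subspace_sum => // j _.
    by apply: subspaceZ => //; case: (wP j).
  rewrite linearB linear_sum fvE; apply/eqP; rewrite subr_eq0; apply/eqP.
  by apply: eq_bigr => j _; rewrite linearZ; case: (wP j) => _ ->.
rewrite -gV => -[c1 _ c1E]; exists (row_mx c1 (\row_j c j)) => //.
rewrite /= /h row_mxKl row_mxKr c1E.
under [X in _ + X = _]eq_bigr do rewrite mxE.
by rewrite subrK.
Qed.

Lemma dim_inj (W W' : lmodType k) (f : {linear W -> W'}) (V : set W) :
  findim V -> (forall v, V v -> f v = 0 -> v = 0) -> dim (f @` V) = dim V.
Proof.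
move=> fV finj; have [_ _ ->] := rank_nullity f fV.
suff -> : [set v | V v /\ f v = 0] = [set 0] by rewrite dim0.
apply/seteqP; split=> [v [Vv fv]|_ ->]; first exact: finj.
by split; [case: (findim_subspace fV) | exact: linear0].
Qed.

Lemma dim_le_inj (W W' : lmodType k) (f : {linear W -> W'}) (V : set W)
    (V' : set W') :
  findim V -> findim V' -> (forall v, V v -> V' (f v)) ->
  (forall v, V v -> f v = 0 -> v = 0) -> (dim V <= dim V')%N.
Proof.
move=> fV fV' fVV' finj; rewrite -(dim_inj fV finj); apply: dim_sub => //.
  by apply: findim_subspace; case: (rank_nullity f fV).
by move=> _ [v Vv <-]; exact: fVV'.
Qed.

(** * Initial spaces *)

Section Initial.
Variables (W E : lmodType k) (c : nat -> {linear W -> E}).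
Implicit Types V : set W.

(** The [c j] are thought of as the coefficients of an expansion in powers of a
    variable, and [order_ge V i] as the elements of [V] of order at least [i]. *)
Definition order_ge V i : set W := [set v | V v /\ forall j, (j < i)%N -> c j v = 0].

(** The leading coefficients of the elements of [V] of order [i], that is, the
    [i]-th piece of the graded space associated with [V]. *)
Definition initial V i : set E := c i @` order_ge V i.

Definition separated V m : Prop :=
  forall v, V v -> (forall j, (j < m)%N -> c j v = 0) -> v = 0.

Lemma order_ge_subspace V i : subspace V -> subspace (order_ge V i).
Proof.
move=> sV; split=> [|a u v [Vu u0] [Vv v0]].
  by split=> [|j _]; [exact: subspace0 | exact: linear0].
split=> [|j ji]; first exact: sV.2.
by rewrite linearP u0 // v0 // scaler0 addr0.
Qed.

Lemma order_ge0 V : order_ge V 0 = V.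
Proof. by apply/seteqP; split=> [v []|v]. Qed.

Lemma order_geS V i : [set v | order_ge V i v /\ c i v = 0] = order_ge V i.+1.
Proof.
apply/seteqP; split=> [v [[Vv v0] vi]|v [Vv v0]].
  by split=> // j; rewrite ltnS leq_eqVlt => /orP[/eqP -> //|/v0].
by split; [split=> // j ji; apply/v0/ltnW | exact: v0].
Qed.

Lemma order_ge_max V m : subspace V -> separated V m -> order_ge V m = [set 0].
Proof.
move=> sV sepV; apply/seteqP; split=> [v [Vv v0]|_ ->]; first exact: sepV.
by split=> [|j _]; [exact: subspace0 | exact: linear0].
Qed.

Lemma initial_subspace V i : subspace V -> subspace (initial V i).
Proof.
move=> /(order_ge_subspace i) sV; split=> [|a _ _ [u Vu <-] [v Vv <-]].
  by exists 0; [exact: subspace0 | exact: linear0].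
by exists (a *: u + v); [exact: sV.2 | rewrite linearP].
Qed.

Lemma initialS U V i : U `<=` V -> initial U i `<=` initial V i.
Proof. by move=> UV _ [u [Uu u0] <-]; exists u => //; split=> //; exact: UV. Qed.

Lemma findim_order_ge V m i : subspace V -> separated V m ->
  (forall j, (j < m)%N -> findim (initial V j)) -> (i <= m)%N ->
  findim (order_ge V i).
Proof.
move=> sV sepV fin.
have [n] := ex_intro (fun n => m - i = n)%N _ erefl.
elim: n i => [|n IH] j nE jm.
  have -> : j = m by apply/eqP; rewrite eqn_leq jm -subn_eq0 nE.
  by rewrite order_ge_max //; exact: findim0.
have jm' : (j < m)%N by rewrite -subn_gt0 nE.
apply: (@findim_extension _ _ (c j)); first exact: order_ge_subspace.
  exact: fin.
by rewrite order_geS; apply: IH => //; rewrite subnS nE.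
Qed.

Lemma findim_from_initial V m : subspace V -> separated V m ->
  (forall j, (j < m)%N -> findim (initial V j)) -> findim V.
Proof.
by move=> sV sepV fin; rewrite -(order_ge0 V); apply: (findim_order_ge sV sepV fin).
Qed.

Lemma findim_initial V i : findim V -> findim (initial V i).
Proof.
move=> fV; have sV := findim_subspace fV.
have : findim (order_ge V i).
  by case: (findim_sub fV (order_ge_subspace i sV)) => // v [].
by move=> /(rank_nullity (c i)) [].
Qed.

Lemma dim_order_ge V m i : findim V -> separated V m -> (i <= m)%N ->
  dim (order_ge V i) = (\sum_(i <= j < m) dim (initial V j))%N.
Proof.
move=> fV sepV; have sV := findim_subspace fV.
have fin j : (j < m)%N -> findim (initial V j) by move=> _; exact: findim_initial.
have [n] := ex_intro (fun n => m - i = n)%N _ erefl.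
elim: n i => [|n IH] j nE jm.
  have -> : j = m by apply/eqP; rewrite eqn_leq jm -subn_eq0 nE.
  by rewrite order_ge_max // dim0 big_geq.
have jm' : (j < m)%N by rewrite -subn_gt0 nE.
have [_ _ ->] := rank_nullity (c j) (findim_order_ge sV sepV fin jm).
by rewrite order_geS IH ?subnS ?nE // [RHS]big_ltn // addnC.
Qed.

(** The kernel of [c i] on [order_ge V i] is [order_ge V i.+1], so that the
    rank-nullity theorem peels off one graded piece after the other. *)
Lemma dim_initial V m : findim V -> separated V m ->
  dim V = (\sum_(i < m) dim (initial V i))%N.
Proof.
by move=> fV sepV; rewrite -{1}[V]order_ge0 (dim_order_ge fV sepV) // big_mkord.
Qed.

End Initial.

Section Sequences.
Variable E : lmodType k.
Implicit Types (U : nat -> set E) (u v : nat -> E).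

Definition entry (i : nat) (u : nat -> E) : E := u i.

Lemma entry_is_linear i : linear (entry i).
Proof. by []. Qed.

HB.instance Definition _ i :=
  GRing.isLinear.Build k (nat -> E) E _ (entry i) (entry_is_linear i).

Definition dsum U m : set (nat -> E) :=
  [set u | forall i, if (i < m)%N then U i (u i) else u i = 0].

Definition single (i : nat) (x : E) : nat -> E := fun j => if j == i then x else 0.

Lemma dsum_single U m i x : (forall j, (j < m)%N -> subspace (U j)) ->
  (i < m)%N -> U i x -> dsum U m (single i x).
Proof.
move=> sU im Uix j; rewrite /single; case: eqP => [->|_]; first by rewrite im.
by case: ifP => // jm; apply: subspace0; exact: sU.
Qed.

Lemma dsum_subspace U m : (forall j, (j < m)%N -> subspace (U j)) ->
  subspace (dsum U m).
Proof.
move=> sU; split=> [i|a u v Du Dv i].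
  by case: ifP => // im; apply: subspace0; exact: sU.
case: ifP (Du i) (Dv i) => im; first exact: (sU _ im).2.
by rewrite /GRing.add /GRing.scale /= => -> ->; rewrite scaler0 addr0.
Qed.

Lemma dsum_separated U m : separated entry (dsum U m) m.
Proof.
move=> u Du u0; apply/funext => i; case: (ltnP i m) => im; first exact: u0.
by move: (Du i); rewrite ltnNge im.
Qed.

Lemma initial_dsum U m i : (forall j, (j < m)%N -> subspace (U j)) ->
  (i < m)%N -> initial entry (dsum U m) i = U i.
Proof.
move=> sU im; apply/seteqP; split=> [_ [u [Du _] <-]|x Ux].
  by move: (Du i); rewrite im.
exists (single i x); last by rewrite /= /entry /single eqxx.
split=> [|j ji]; first exact: dsum_single.
by rewrite /= /entry /single ltn_eqF.
Qed.

Lemma findim_dsum U m : (forall j, (j < m)%N -> findim (U j)) ->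
  findim (dsum U m).
Proof.
move=> fU; have sU j : (j < m)%N -> subspace (U j) by move=> /fU/findim_subspace.
apply: (findim_from_initial (dsum_subspace sU) (@dsum_separated U m)) => j jm.
by rewrite initial_dsum //; exact: fU.
Qed.

Lemma dim_dsum U m : (forall j, (j < m)%N -> findim (U j)) ->
  dim (dsum U m) = (\sum_(i < m) dim (U i))%N.
Proof.
move=> fU; have sU j : (j < m)%N -> subspace (U j) by move=> /fU/findim_subspace.
rewrite (dim_initial (findim_dsum fU) (@dsum_separated U m)).
by apply: eq_bigr => i _; rewrite initial_dsum.
Qed.

End Sequences.

End Subspaces.

(** * Growth of subspaces *)

Section Growth.
Variables (k : fieldType) (E : lmodType k) (I : finType).
Variable X : I -> {linear E -> E}.
Implicit Types (U V : set E).

Definition grow V : set E :=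
  [set v | exists2 f : I -> E, (forall a, V (f a)) & v = \sum_a X a (f a)].

Definition addset U V : set E :=
  [set w | exists u v, [/\ U u, V v & w = u + v]].

Lemma grow_subspace V : subspace V -> subspace (grow V).
Proof.
move=> sV; split=> [|c _ _ [f Vf ->] [g Vg ->]].
  by exists (fun=> 0) => [a|]; [exact: subspace0 | rewrite big1 // => a _; exact: linear0].
exists (fun a => c *: f a + g a) => [a|]; first exact: sV.2.
rewrite scaler_sumr -big_split; apply: eq_bigr => a _ /=.
by rewrite linearP.
Qed.

Lemma grow_least V V' : subspace V' -> (forall a v, V v -> V' (X a v)) ->
  grow V `<=` V'.
Proof. by move=> sV' VV' _ [f Vf ->]; apply: subspace_sum => // a _; exact/VV'. Qed.

Lemma grow_mem V a v : subspace V -> V v -> grow V (X a v).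
Proof.
move=> sV Vv; exists (fun b => if b == a then v else 0) => [b|].
  by case: eqP => _ //; exact: subspace0.
by rewrite (bigD1 a) //= eqxx big1 ?addr0 // => b /negbTE ->; exact: linear0.
Qed.

Lemma growS U V : U `<=` V -> grow U `<=` grow V.
Proof. by move=> UV _ [f Uf ->]; exists f => // a; exact/UV. Qed.

Lemma addset_subspace U V : subspace U -> subspace V -> subspace (addset U V).
Proof.
move=> sU sV; split=> [|c _ _ [u1 [v1 [Uu1 Vv1 ->]]] [u2 [v2 [Uu2 Vv2 ->]]]].
  by exists 0, 0; rewrite addr0; split=> //; exact: subspace0.
exists (c *: u1 + u2), (c *: v1 + v2).
by split; [exact: sU.2 | exact: sV.2 | rewrite scalerDr addrACA].
Qed.

Lemma addset_least U V V' : subspace V' -> U `<=` V' -> V `<=` V' ->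
  addset U V `<=` V'.
Proof. by move=> sV' UV' VV' _ [u [v [Uu Vv ->]]]; apply: subspaceD; auto. Qed.

Lemma addset_subl U V : subspace V -> U `<=` addset U V.
Proof. by move=> sV u Uu; exists u, 0; rewrite addr0; split=> //; exact: subspace0. Qed.

Lemma addset_subr U V : subspace U -> V `<=` addset U V.
Proof. by move=> sU v Vv; exists 0, v; rewrite add0r; split=> //; exact: subspace0. Qed.

Lemma dim_lt U V v : findim V -> subspace U -> U `<=` V -> V v -> ~ U v ->
  (dim U < dim V)%N.
Proof.
move=> fV sU UV Vv nUv; rewrite ltnNge; apply/negP => le.
by apply: nUv; rewrite (dim_sub_eq fV sU UV le).
Qed.

(** In the direct sum of the [U i z^i], for an extra variable [z], the multiples
    by the [X a] and by [z] have [level_grow U i] as coefficient space of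
    [z^i]. *)
Definition level_grow (U : nat -> set E) i : set E :=
  if i is i'.+1 then addset (U i') (grow (U i)) else grow (U 0%N).

Lemma level_grow_subspace (U : nat -> set E) i : (forall i, subspace (U i)) ->
  subspace (level_grow U i).
Proof.
by move=> sU; case: i => [|i] /=; try apply: addset_subspace => //; exact: grow_subspace.
Qed.

Lemma level_grow_least (U : nat -> set E) i V : subspace V ->
  (forall a v, U i v -> V (X a v)) -> (forall j, i = j.+1 -> U j `<=` V) ->
  level_grow U i `<=` V.
Proof.
move=> sV; case: i => [|i] /= UV1 UV2; first exact: grow_least.
by apply: addset_least => //; [exact: UV2 | exact: grow_least].
Qed.

Lemma level_grow_mem (U : nat -> set E) i a v : (forall i, subspace (U i)) ->
  U i v -> level_grow U i (X a v).
Proof.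
move=> sU Uv; case: i Uv => [|i] Uv /=; first exact: grow_mem.
by apply: addset_subr => //; exact: grow_mem.
Qed.

Lemma level_grow_shift (U : nat -> set E) i : (forall i, subspace (U i)) ->
  U i `<=` level_grow U i.+1.
Proof. by move=> sU; apply: addset_subl; exact: grow_subspace. Qed.

(** Growth does not increase when a subspace is replaced by its initial spaces,
    because the leading coefficient of a multiple is the multiple of the leading
    coefficient.  Only leading coefficients have to be multiplied correctly, so
    that an operator on [W] may differ from [X a] in the higher terms. *)
Lemma dim_level_grow_initial (W : lmodType k) (c : nat -> {linear W -> E})
    (V V' : set W) m :
  subspace V -> findim V' -> separated c V' m ->
  (forall a v, V v -> exists2 w, V' w & forall i,
     (forall j, (j < i)%N -> c j v = 0) ->
     (forall j, (j < i)%N -> c j w = 0) /\ c i w = X a (c i v)) ->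
  (forall v, V v -> exists2 w, V' w & forall i,
     (forall j, (j < i)%N -> c j v = 0) ->
     (forall j, (j < i.+1)%N -> c j w = 0) /\ c i.+1 w = c i v) ->
  (\sum_(i < m) dim (level_grow (initial c V) i) <= dim V')%N.
Proof.
move=> sV fV' sepV' opV shiftV; rewrite (dim_initial fV' sepV').
have sI i : subspace (initial c V i) by exact: initial_subspace.
have sI' i : subspace (initial c V' i).
  by apply: initial_subspace; exact: findim_subspace.
apply: leq_sum => i _; apply: dim_sub.
- exact: findim_initial.
- exact: level_grow_subspace.
apply: level_grow_least => [//|a _ [v [Vv v0] <-]|j ij _ [v [Vv v0] <-]].
  have [w V'w /(_ i v0) [w0 wi]] := opV a v Vv.
  by exists w.
have [w V'w /(_ j v0) [w0 wi]] := shiftV v Vv.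
by exists w; rewrite ij.
Qed.

End Growth.

(** * Stabilisation *)

Section Stabilisation.
Variables (k : fieldType) (E : lmodType k) (I : finType).
Variable X : I -> {linear E -> E}.
Hypothesis XC : forall a b v, X a (X b v) = X b (X a v).

Section Twist.
Variable b : I.

(** With sequences read as polynomials in a variable [z], this is the linear
    map that fixes [1] and sends [z^i] to [(z - x) z^(i-1)] for [i > 0], where
    [x] is the operator [X b]. *)
Definition twist (u : nat -> E) : nat -> E := fun i => u i - X b (u i.+1).

Lemma twist_is_linear : linear twist.
Proof.
move=> c u v; apply/funext => i; rewrite /twist /=.
rewrite /GRing.add /GRing.scale /= linearP scalerBr opprD addrACA.
by [].
Qed.

HB.instance Definition _ := GRing.isLinear.Build k (nat -> E) (nat -> E) _
  twist twist_is_linear.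

Lemma twist_eq0 m u : (forall i, (m <= i)%N -> u i = 0) ->
  (forall i, (i < m)%N -> twist u i = 0) -> u = 0.
Proof.
move=> um tw; apply/funext => i.
have [j] := ex_intro (fun j => m - i = j)%N _ erefl.
elim: j i => [|j IH] i ji; first by apply: um; rewrite -subn_eq0 ji.
have im : (i < m)%N by rewrite -subn_gt0 ji.
have /eqP := tw i im; rewrite /twist subr_eq0 => /eqP ->.
by rewrite IH ?linear0 // subnS ji.
Qed.

End Twist.

Definition truncate (j : nat) (u : nat -> E) : nat -> E :=
  fun i => if (i < j)%N then 0 else u i.

Lemma truncate_is_linear j : linear (truncate j).
Proof.
move=> c u v; apply/funext => i; rewrite /truncate /GRing.add /GRing.scale /=.
by case: ifP => // _; rewrite scaler0 addr0.
Qed.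

HB.instance Definition _ j := GRing.isLinear.Build k (nat -> E) (nat -> E) _
  (truncate j) (truncate_is_linear j).

Variables (m : nat) (H : nat -> set E).
Hypothesis fH : forall i, findim (H i).
Hypothesis XH : forall a i v, (i < m)%N -> H i.+1 v -> H i (X a v).

(** [H i.+1] is the ambient space of the coefficients of [z^i]; the shift makes
    room for the coefficients in the next degree, which lie in [H i]. *)
Definition bounded (U : nat -> set E) : Prop :=
  [/\ forall i, subspace (U i), forall i, (i < m)%N -> U i `<=` H i.+1
    & forall i, (m <= i)%N -> U i = [set 0]].

Definition stable (U : nat -> set E) : Prop :=
  forall a i v, U i.+1 v -> U i (X a v).

Definition size_of (U : nat -> set E) := (\sum_(i < m) dim (U i))%N.
Definition growth_of (U : nat -> set E) :=
  (\sum_(i < m.+1) dim (level_grow X U i))%N.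

(** This is [size_of U] plus the sum of the [i * dim (U i)]; the form with
    [order_ge] also makes sense for subspaces that are not direct sums. *)
Definition potential (U : nat -> set E) :=
  (\sum_(j < m) dim (order_ge (@entry k E) (dsum U m) j))%N.

Section Bounded.
Variable U : nat -> set E.
Hypothesis bU : bounded U.

Lemma bounded_subspace i : subspace (U i). Proof. by case: bU => sU _ _; exact: sU. Qed.

Lemma bounded_findim i : findim (U i).
Proof.
case: bU => sU UH U0; case: (ltnP i m) => im; last by rewrite U0 //; exact: findim0.
by case: (findim_sub (fH i.+1) (sU i) (UH _ im)).
Qed.

Lemma level_grow_bounded i : (i < m.+1)%N -> level_grow X U i `<=` H i.
Proof.
case: bU => sU UH U0 im; have sH := findim_subspace (fH i).
apply: level_grow_least => // [a v|j ij]; last first.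
  by rewrite ij; apply: UH; rewrite -ltnS -ij.
case: (ltnP i m) => i_m; first by move=> /(UH _ i_m); exact: XH.
by rewrite U0 // => ->; rewrite linear0; exact: subspace0.
Qed.

Lemma findim_level_grow i : (i < m.+1)%N -> findim (level_grow X U i).
Proof.
move=> im; have sG := level_grow_subspace X i bounded_subspace.
by case: (findim_sub (fH i) sG (level_grow_bounded im)).
Qed.

Lemma dsum_out u i : dsum U m u -> (m <= i)%N -> u i = 0.
Proof. by move=> Du mi; move: (Du i); rewrite ltnNge mi. Qed.

Lemma dsum_mem u i : dsum U m u -> U i (u i).
Proof.
move=> Du; case: (ltnP i m) => im; first by move: (Du i); rewrite im.
by rewrite (dsum_out Du im); apply: subspace0; exact: bounded_subspace.
Qed.

End Bounded.

Section Step.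
Variables (U : nat -> set E) (b : I).
Hypothesis bU : bounded U.

Let D := dsum U m.
Let W := twist b @` D.
Let U' := initial (@entry k E) W.

Let fD : findim D. Proof. by apply: findim_dsum => i _; exact: bounded_findim. Qed.

Let fW : findim W. Proof. by case: (rank_nullity (twist b) fD). Qed.

Let Wout w i : W w -> (m <= i)%N -> w i = 0.
Proof.
move=> [u Du <-] mi; rewrite /= /twist (dsum_out Du mi).
by rewrite (dsum_out Du (leqW mi)) linear0 subr0.
Qed.

Let sepW : separated (@entry k E) W m.
Proof.
move=> w Ww w0; apply/funext => i; case: (ltnP i m) => im; first exact: w0.
exact: Wout.
Qed.

Let twist_inj u : D u -> twist b u = 0 -> u = 0.
Proof.
move=> Du tu; apply: (@twist_eq0 b m) => [i mi|i _]; last by rewrite tu.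
exact: dsum_out Du mi.
Qed.

Let bU' : bounded U'.
Proof.
split=> [i|i im _ [w [[u Du <-] _] <-]|i mi].
- by apply: initial_subspace; exact: findim_subspace.
- have [_ UH _] := bU; have sH := findim_subspace (fH i.+1).
  rewrite /= /entry /twist; apply: subspaceB => //.
    by apply: UH => //; exact: dsum_mem Du.
  case: (ltnP i.+1 m) => im'; last first.
    by rewrite (dsum_out Du im') linear0; exact: subspace0.
  by apply: XH => //; apply: UH => //; exact: dsum_mem Du.
- apply/seteqP; split=> [_ [w [Ww _] <-]|_ ->]; first exact: Wout.
  by apply: subspace0; apply: initial_subspace; exact: findim_subspace.
Qed.

Let size_step : size_of U' = size_of U.
Proof.
rewrite /size_of -(dim_initial fW sepW) dim_inj // dim_dsum // => i _.
exact: bounded_findim.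
Qed.

(** The twist of the space spanned by the multiples of [D] contains the
    multiples of the twist of [D]. *)
Let growth_step : (growth_of U' <= growth_of U)%N.
Proof.
pose G := level_grow X U.
have sU i : subspace (U i) by exact: bounded_subspace.
have fG i : (i < m.+1)%N -> findim (G i) by exact: findim_level_grow.
have sG i : (i < m.+1)%N -> subspace (G i) by move=> /fG/findim_subspace.
have tw0 u : dsum G m.+1 u -> twist b u = 0 -> u = 0.
  move=> Du tu; apply: (@twist_eq0 b m.+1) => [i mi|i _]; last by rewrite tu.
  by move: (Du i); rewrite ltnNge mi.
have fV' : findim (twist b @` dsum G m.+1).
  by case: (rank_nullity (twist b) (findim_dsum fG)).
rewrite /growth_of -(dim_dsum fG) -(dim_inj (findim_dsum fG) tw0).
apply: dim_level_grow_initial => //.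
- exact: findim_subspace.
- move=> w [u Du <-] w0; apply/funext => i; case: (ltnP i m.+1) => im; first exact: w0.
  have uout l : (m < l)%N -> u l = 0 by move=> ml; move: (Du l); rewrite ltnNge ml.
  by rewrite /= /twist (uout i im) (uout i.+1 (leqW im)) linear0 subr0.
- move=> a _ [u Du <-]; exists (twist b (fun i => X a (u i))).
    exists (fun i => X a (u i)) => // i; case: ifP => im.
      by apply: level_grow_mem => //; exact: dsum_mem Du.
    by rewrite (dsum_out Du) ?linear0 //; apply: leq_trans (leqnSn _) _; rewrite leqNgt im.
  have E1 i : twist b (fun i => X a (u i)) i = X a (twist b u i).
    by rewrite /twist linearB XC.
  move=> i w0; split=> [j ji|]; last exact: E1.
  by apply: etrans (E1 j) _; rewrite [twist b u j](w0 _ ji) linear0.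
- move=> _ [u Du <-].
  (* [z] times the twist of [u] is the twist of [z u] plus [X b (u 0)], and the
     latter belongs to the level of [z^0]. *)
  pose u' i := if i is j.+1 then u j else X b (u 0%N).
  exists (twist b u').
    exists u' => // -[|i] /=.
      by apply: grow_mem => //; exact: dsum_mem Du.
    rewrite ltnS; case: ifP => im; last by apply: (dsum_out Du); rewrite leqNgt im.
    by apply: level_grow_shift => //; exact: dsum_mem Du.
  move=> i w0; split=> // -[_|j ji]; last exact: (w0 j ji).
  by rewrite /= /entry /twist /= subrr.
Qed.

(** An element [u] of [Z j] is determined by its entries from [j] on, since
    those below [j] satisfy [u i = X b (u i.+1)]; truncation therefore embeds
    [Z j] into [order_ge D j]. *)
Let Z j : set (nat -> E) := [set u | D u /\ order_ge (@entry k E) W j (twist b u)].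

Let Z_subspace j : subspace (Z j).
Proof.
have sD := findim_subspace fD.
have sO := order_ge_subspace (@entry k E) j (findim_subspace fW).
split=> [|c u v [Du Ou] [Dv Ov]]; first by split; rewrite ?linear0; exact: subspace0.
by split; [exact: sD.2 | rewrite linearP; exact: sO.2].
Qed.

Let Z_twist j u i : Z j u -> (i < j)%N -> u i = X b (u i.+1).
Proof. by move=> [_ [_ /(_ i)]] + ij; move=> /(_ ij)/eqP; rewrite subr_eq0 => /eqP. Qed.

Let fZ j : findim (Z j).
Proof. by case: (findim_sub fD (Z_subspace j)) => // u []. Qed.

Let truncate_inj j u : Z j u -> truncate j u = 0 -> u = 0.
Proof.
move=> Zu tu; apply: (@twist_eq0 b j) => [i ji|i ij].
  by have := congr1 (fun w => w i) tu; rewrite /truncate ltnNge ji.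
by rewrite /twist -(Z_twist Zu ij) subrr.
Qed.

Let dim_Z j : dim (order_ge (@entry k E) W j) = dim (Z j).
Proof.
have -> : order_ge (@entry k E) W j = twist b @` Z j.
  apply/seteqP; split=> [w Ow|_ [u [_ Ou] <-] //].
  by have [[u Du uw] _] := Ow; exists u => //; split=> //; rewrite uw.
by apply: dim_inj => // u [Du _]; exact: twist_inj.
Qed.

Let truncate_mem j u : D u -> order_ge (@entry k E) D j (truncate j u).
Proof.
move=> Du; split=> [i|i ij]; last by rewrite /= /entry /truncate ij.
rewrite /= /truncate.
have := Du i; case: (ltnP i j) => // _; case: (ltnP i m) => // im _.
by apply: subspace0; exact: bounded_subspace.
Qed.

Let fO j : findim (order_ge (@entry k E) D j).
Proof.
by case: (findim_sub fD (order_ge_subspace (@entry k E) j (findim_subspace fD))) => // u [].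
Qed.

Let fT j : findim (truncate j @` Z j).
Proof. by case: (rank_nullity (truncate j) (fZ j)). Qed.

Let dim_order_step j : (dim (order_ge (@entry k E) W j) <=
  dim (order_ge (@entry k E) D j))%N.
Proof.
rewrite dim_Z; apply: dim_le_inj (fZ j) (fO j) _ (@truncate_inj j).
by move=> u [Du _]; exact: truncate_mem.
Qed.

Let potential_U' : potential U' = (\sum_(j < m) dim (order_ge (@entry k E) W j))%N.
Proof.
have fD' : findim (dsum U' m) by apply: findim_dsum => i _; exact: bounded_findim.
apply: eq_bigr => j _.
rewrite (dim_order_ge fD' (@dsum_separated _ _ _ _)) ?(ltnW (ltn_ord j)) //.
rewrite (dim_order_ge fW sepW) ?(ltnW (ltn_ord j)) //.
apply: eq_big_nat => i /andP[_ im]; rewrite initial_dsum // => l _.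
exact: bounded_subspace.
Qed.

(** At [j = i.+1] the embedding of [Z j] is not onto: an entry [u] such that
    [X b u] is outside [U i] is not attained. *)
Lemma stabilisation_step i u : (i.+1 < m)%N -> U i.+1 u -> ~ U i (X b u) ->
  exists U', [/\ bounded U', size_of U' = size_of U,
    (growth_of U' <= growth_of U)%N & (potential U' < potential U)%N].
Proof.
move=> im Uu nU; exists U'; split=> //.
rewrite potential_U' (bigD1 (Ordinal im)) //= /potential [ltnRHS](bigD1 (Ordinal im)) //=.
rewrite -addSn leq_add ?leq_sum //= dim_Z -(dim_inj (fZ _) (@truncate_inj _)).
apply: (@dim_lt _ _ _ _ (single i.+1 u)) => //.
- exact: findim_subspace.
- by move=> _ [w [Dw _] <-]; exact: truncate_mem.
- split=> [|j ji]; last by rewrite /= /entry /single ltn_eqF.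
  by apply: dsum_single => // j _; exact: bounded_subspace.
- move=> [w Zw tw]; apply: nU; have [Dw _] := Zw.
  have -> : u = w i.+1.
    by have := congr1 (fun w => w i.+1) tw; rewrite /= /truncate /single ltnn eqxx.
  by rewrite -(Z_twist Zw) //; exact: dsum_mem Dw.
Qed.

End Step.

Lemma unstable_step U : bounded U -> ~ stable U ->
  exists U', [/\ bounded U', size_of U' = size_of U,
    (growth_of U' <= growth_of U)%N & (potential U' < potential U)%N].
Proof.
move=> bU /existsNP[b /existsNP[i /existsNP[u /not_implyP[Uu nU]]]].
apply: (stabilisation_step bU _ Uu nU).
rewrite ltnNge; apply/negP => mi; apply: nU.
have [sU _ U0] := bU; move: Uu; rewrite (U0 i.+1) // => ->.
by rewrite linear0; exact: subspace0.
Qed.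

(** A family of least potential is stable, as an operator that moves some
    [U i.+1] outside [U i] allows a further twist. *)
Lemma stabilisation U : bounded U -> exists U',
  [/\ bounded U', stable U', size_of U' = size_of U
    & (growth_of U' <= growth_of U)%N].
Proof.
have [n] := ex_intro (fun n => potential U <= n)%N _ (leqnn _).
elim: n U => [|n IH] U Un bU.
  have [stU|nst] := pselect (stable U); first by exists U; split.
  have [U' [_ _ _]] := unstable_step bU nst.
  by rewrite ltnNge (leq_trans Un).
have [stU|nst] := pselect (stable U); first by exists U; split.
have [U' [bU' sizeU' growU' potU']] := unstable_step bU nst.
have [|U'' [bU'' stU'' sizeU'' growU'']] := IH U' _ bU'.
  by rewrite -ltnS; exact: leq_trans potU' Un.
exists U''; split=> //; first by rewrite sizeU''.
exact: leq_trans growU'' growU'.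
Qed.

End Stabilisation.

(** * Greedy sequences *)

Section GreedySequences.
Local Open Scope nat_scope.
Variables (d : nat -> nat) (g : nat -> nat -> nat).
Hypothesis g0 : forall s, g s 0 = 0.
Hypothesis g_mono : forall s i j, i <= j -> j <= d s -> g s i <= g s j.
Hypothesis g_le : forall s j, j <= d s -> g s j <= d s.+1.

(** The upper adjoint of [g s]. *)
Definition gstar s c := \max_(j < (d s).+1 | g s j <= c) j.

Lemma gstar_le s c : gstar s c <= d s.
Proof. by apply/bigmax_leqP => j _; rewrite -ltnS. Qed.

Lemma gstar_max s c j : j <= d s -> g s j <= c -> j <= gstar s c.
Proof.
rewrite -ltnS => jd gj; rewrite /gstar.
exact: (leq_bigmax_cond (F := fun i : 'I_(d s).+1 => i : nat) (Ordinal jd) gj).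
Qed.

Lemma g_gstar s c : g s (gstar s c) <= c.
Proof.
rewrite /gstar; elim/big_ind: _ => [|i j gi gj|//]; first by rewrite g0.
by rewrite /maxn; case: ifP.
Qed.

Lemma gstar_mono s c c' : c <= c' -> gstar s c <= gstar s c'.
Proof.
by move=> cc'; apply: gstar_max (gstar_le _ _) (leq_trans (g_gstar _ _) cc').
Qed.

(** The largest sum of a stable sequence with first entry [c]. *)
Fixpoint capacity t c :=
  if t is t'.+1 then c + capacity t' (gstar t' c) else c.

Definition total_dim t := \sum_(s < t.+1) d s.

Lemma capacity_mono t c c' : c <= c' -> capacity t c + (c' - c) <= capacity t c'.
Proof.
elim: t c c' => [|t IH] c c' cc' /=; first by rewrite subnKC.
have := IH _ _ (gstar_mono t cc'); lia.
Qed.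

Lemma leq_capacity t c : c <= capacity t c.
Proof. by case: t => [|t] //=; exact: leq_addr. Qed.

Lemma gstar_full t : gstar t (d t.+1) = d t.
Proof. by apply/eqP; rewrite eqn_leq gstar_le gstar_max // g_le. Qed.

Lemma capacity_full t : capacity t (d t) = total_dim t.
Proof.
elim: t => [|t IH]; rewrite /total_dim big_ord_recr /=; first by rewrite big_ord0.
by rewrite gstar_full IH addnC.
Qed.

Lemma capacity_gstar_le t c : capacity t (gstar t c) <= total_dim t.
Proof.
by rewrite -capacity_full; have := capacity_mono t (gstar_le t c); lia.
Qed.

Lemma top_exists t h : exists c, h <= capacity t c.
Proof. by exists h; exact: leq_capacity. Qed.

Definition top_entry t h := ex_minn (top_exists t h).

Lemma topP t h : h <= capacity t (top_entry t h).
Proof. by rewrite /top_entry; case: ex_minnP. Qed.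

Lemma top_min t h c : h <= capacity t c -> top_entry t h <= c.
Proof. by rewrite /top_entry; case: ex_minnP => m _; apply. Qed.

Lemma lt_top t h c : c < top_entry t h -> capacity t c < h.
Proof. by move=> ct; rewrite ltnNge; apply: contraL ct => /top_min; rewrite leqNgt. Qed.

Lemma top_le t h : top_entry t h <= h.
Proof. by apply: top_min; exact: leq_capacity. Qed.

Lemma top_mono t h h' : h <= h' -> top_entry t h <= top_entry t h'.
Proof. by move=> hh'; apply: top_min; exact: leq_trans hh' (topP _ _). Qed.

Lemma rest_mono t h h' : h <= h' -> h - top_entry t h <= h' - top_entry t h'.
Proof.
move=> hh'; suff : top_entry t h' <= top_entry t h + (h' - h) by have := top_le t h; lia.
apply: top_min; have := @capacity_mono t (top_entry t h) (top_entry t h + (h' - h)).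
have := topP t h; lia.
Qed.

Lemma top_le_dim t h : h <= total_dim t -> top_entry t h <= d t.
Proof. by move=> ht; apply: top_min; rewrite capacity_full. Qed.

Lemma rest_le_capacity t h :
  h - top_entry t.+1 h <= capacity t (gstar t (top_entry t.+1 h)).
Proof. by have := topP t.+1 h; rewrite /= leq_subLR. Qed.

Lemma rest_le_total t h : h - top_entry t.+1 h <= total_dim t.
Proof. exact: leq_trans (rest_le_capacity _ _) (capacity_gstar_le _ _). Qed.

(** When a variable is added to a polynomial ring, these are the numbers of
    monomials in a lexicographic segment of [h] monomials, sorted by their
    exponent in the new, last variable. *)
Fixpoint greedy t h i :=
  match i, t with
  | 0, _ => top_entry t h
  | i'.+1, t'.+1 => greedy t' (h - top_entry t h) i'
  | _.+1, 0 => 0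
  end.

Lemma greedy_top t h : greedy t h 0 = top_entry t h. Proof. by case: t. Qed.

Lemma greedy_sum t h : h <= total_dim t -> \sum_(i < t.+1) greedy t h i = h.
Proof.
elim: t h => [|t IH] h ht.
  rewrite big_ord_recl big_ord0 addn0 greedy_top.
  by apply/eqP; rewrite eqn_leq top_le; exact: (topP 0 h).
rewrite big_ord_recl greedy_top /=.
rewrite (eq_bigr (fun i : 'I_t.+1 => greedy t (h - top_entry t.+1 h) i)) //.
by rewrite IH ?rest_le_total // subnKC // top_le.
Qed.

Lemma greedy_le_dim t h i : h <= total_dim t -> i <= t -> greedy t h i <= d (t - i).
Proof.
elim: t h i => [|t IH] h [|i] ht it //; try by rewrite greedy_top subn0 top_le_dim.
by rewrite /= subSS; apply: IH; rewrite ?rest_le_total.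
Qed.

Lemma greedy_mono t h h' i : h <= h' -> greedy t h i <= greedy t h' i.
Proof.
elim: t h h' i => [|t IH] h h' [|i] hh' //; try by rewrite !greedy_top top_mono.
by apply: IH; exact: rest_mono.
Qed.

Lemma greedy_stable t h i : i < t ->
  g (t - i.+1) (greedy t h i.+1) <= greedy t h i.
Proof.
elim: t h i => [|t IH] h [|i] it //; last by rewrite /= subSS; exact: IH.
rewrite /= subSS subn0 !greedy_top.
apply: leq_trans (g_gstar t (top_entry t.+1 h)).
apply: g_mono (gstar_le _ _); apply: top_min; exact: rest_le_capacity.
Qed.

(** By adjunction: the first entry [g t c] leaves room for [capacity t c], at
    least [h], whereas a smaller one only leaves room for [capacity t c.-1],
    which is less than [h]. *)
Lemma top_growth t h : h <= total_dim t ->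
  top_entry t.+1 (h + g t (top_entry t h)) = g t (top_entry t h).
Proof.
move=> ht; set c := top_entry t h; have cd : c <= d t by exact: top_le_dim.
apply/eqP; rewrite eqn_leq; apply/andP; split.
  apply: top_min => /=; rewrite addnC leq_add2l.
  apply: leq_trans (topP t h) _.
  have /(@capacity_mono t) := gstar_max cd (leqnn (g t c)); rewrite -/c; lia.
rewrite leqNgt; apply/negP => lt; set e := top_entry _ _ in lt.
have := topP t.+1 (h + g t c); rewrite -/e /=.
have ec : gstar t e < c.
  rewrite ltnNge; apply: contraL lt => /g_mono/(_ (gstar_le _ _)).
  by rewrite -leqNgt => /leq_trans; apply; exact: g_gstar.
have /(@lt_top t) := ec; lia.
Qed.

Lemma greedy_growth t h h' i : h <= total_dim t -> h + g t (top_entry t h) <= h' ->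
  i <= t -> greedy t h i <= greedy t.+1 h' i.+1 /\
            g (t - i) (greedy t h i) <= greedy t.+1 h' i.
Proof.
move=> ht hh' it; have := top_growth ht; set h1 := h + _ in hh' * => h1E.
have shift j : greedy t h j <= greedy t.+1 h' j.+1.
  apply: leq_trans (greedy_mono t.+1 j.+1 hh').
  by rewrite /= h1E addnK.
split; first exact: shift.
case: i it => [_|i it].
  rewrite subn0 greedy_top -h1E -(greedy_top t.+1 h1); exact: greedy_mono.
exact: leq_trans (greedy_stable h it) (shift i).
Qed.

(** A stable sequence has sum at most the capacity of its first entry. *)
Lemma top_least t (v : nat -> nat) :
  (forall i, i <= t -> v i <= d (t - i)) ->
  (forall i, i < t -> g (t - i.+1) (v i.+1) <= v i) ->
  top_entry t (\sum_(i < t.+1) v i) <= v 0.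
Proof.
move=> vd vg; apply: top_min.
elim: t v vd vg => [|t IH] v vd vg; first by rewrite big_ord_recl big_ord0 addn0.
rewrite big_ord_recl /= leq_add2l.
apply: leq_trans (IH (fun i => v i.+1) _ _) _ => [i it|i it|].
- by have := vd i.+1 it; rewrite subSS.
- by have := vg i.+1 it; rewrite !subSS.
have v1 : v 1 <= gstar t (v 0).
  apply: gstar_max; first by have := vd 1 isT; rewrite subSS subn0.
  by have := vg 0 isT; rewrite subSS subn0.
have := capacity_mono t v1; lia.
Qed.

End GreedySequences.

(** * Segments *)

(** The last condition says that the growth of [L t h] is contained in every
    [L t.+1 h'] with [h'] at least the growth of some space of dimension [h]; so
    the growth of a segment is a segment, and is the least possible one. *)
Definition segments (k : fieldType) (E : lmodType k) (I : finType)
    (X : I -> {linear E -> E}) (gr : nat -> set E) (L : nat -> nat -> set E) :=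
  [/\ forall t h, (h <= dim (gr t))%N ->
        [/\ findim (L t h), L t h `<=` gr t & dim (L t h) = h],
      forall t h h', (h <= h')%N -> (h' <= dim (gr t))%N -> L t h `<=` L t h'
    & forall t (V : set E) h', findim V -> V `<=` gr t ->
        (dim (grow X V) <= h')%N -> (h' <= dim (gr t.+1))%N ->
        forall a v, L t (dim V) v -> L t.+1 h' (X a v)].

Section SegmentGrowth.
Variables (k : fieldType) (E : lmodType k) (I : finType).
Variables (X : I -> {linear E -> E}) (gr : nat -> set E).
Variable L : nat -> nat -> set E.
Hypothesis fgr : forall t, findim (gr t).
Hypothesis Xgr : forall a t v, gr t v -> gr t.+1 (X a v).
Hypothesis segL : segments X gr L.

Definition seg_growth s j := dim (grow X (L s j)).

Lemma findim_segment t h : (h <= dim (gr t))%N -> findim (L t h).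
Proof. by case: segL => + _ _ => /[apply] -[]. Qed.

Lemma segment_sub t h : (h <= dim (gr t))%N -> L t h `<=` gr t.
Proof. by case: segL => + _ _ => /[apply] -[]. Qed.

Lemma dim_segment t h : (h <= dim (gr t))%N -> dim (L t h) = h.
Proof. by case: segL => + _ _ => /[apply] -[]. Qed.

Lemma segment_mono t h h' : (h <= h')%N -> (h' <= dim (gr t))%N -> L t h `<=` L t h'.
Proof. by case: segL => _ + _; apply. Qed.

Lemma findim_grow t (V : set E) : findim V -> V `<=` gr t ->
  [/\ findim (grow X V), grow X V `<=` gr t.+1 & (dim (grow X V) <= dim (gr t.+1))%N].
Proof.
move=> fV Vgr; have sub : grow X V `<=` gr t.+1.
  by apply: grow_least => [|a v /Vgr]; [exact/findim_subspace/fgr | exact: Xgr].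
have sG := grow_subspace X (findim_subspace fV).
by case: (findim_sub (fgr t.+1) sG sub).
Qed.

Lemma seg_growth_min t (V : set E) : findim V -> V `<=` gr t ->
  (seg_growth t (dim V) <= dim (grow X V))%N.
Proof.
move=> fV Vgr; have [fG _ Gd] := findim_grow fV Vgr.
have Vd : (dim V <= dim (gr t))%N.
  by apply: dim_sub Vgr => //; exact: findim_subspace.
rewrite -[leqRHS](dim_segment Gd); apply: dim_sub.
- exact: findim_segment.
- exact/grow_subspace/findim_subspace/findim_segment.
apply: grow_least; first exact/findim_subspace/findim_segment.
by case: segL => _ _ LX a v Lv; exact: (LX t V).
Qed.

Lemma segmentX t j j' a v : (j <= dim (gr t))%N -> (j' <= dim (gr t.+1))%N ->
  (seg_growth t j <= j')%N -> L t j v -> L t.+1 j' (X a v).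
Proof.
move=> jd j'd gj Lv; case: segL => _ _ LX.
by apply: (LX t (L t j)) => //; rewrite ?dim_segment //;
  [exact: findim_segment | exact: segment_sub].
Qed.

Lemma dim_eq0 (V : set E) : findim V -> dim V = 0%N -> V = [set 0].
Proof.
move=> fV V0; have sV := findim_subspace fV.
suff <- : [set 0] = V by [].
apply: dim_sub_eq => //; last by rewrite V0.
  exact: subspace_zero.
by move=> _ ->; exact: subspace0.
Qed.

Lemma seg_growth0 s : seg_growth s 0 = 0%N.
Proof.
have L0 := dim_eq0 (findim_segment (leq0n _)) (dim_segment (leq0n (dim (gr s)))).
rewrite /seg_growth L0; apply/eqP; rewrite -leqn0 -(dim0 E).
apply: dim_sub; [exact: findim0 | exact/grow_subspace/subspace_zero|].
by apply: grow_least => [|a v ->]; [exact: subspace_zero | rewrite linear0].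
Qed.

Lemma seg_growth_mono s i j : (i <= j)%N -> (j <= dim (gr s))%N ->
  (seg_growth s i <= seg_growth s j)%N.
Proof.
move=> ij jd; have id := leq_trans ij jd.
have [fG _ _] := findim_grow (findim_segment jd) (segment_sub jd).
apply: dim_sub => //; first exact/grow_subspace/findim_subspace/findim_segment.
exact/growS/segment_mono.
Qed.

Lemma seg_growth_le s j : (j <= dim (gr s))%N -> (seg_growth s j <= dim (gr s.+1))%N.
Proof. by move=> jd; case: (findim_grow (findim_segment jd) (segment_sub jd)). Qed.

End SegmentGrowth.

(** * Lifting segments *)

Section Transfer.
Variables (k : fieldType) (E : lmodType k) (I : finType).
Variables (X : I -> {linear E -> E}) (gr : nat -> set E) (L : nat -> nat -> set E).
Hypothesis XC : forall a b v, X a (X b v) = X b (X a v).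
Hypothesis fgr : forall t, findim (gr t).
Hypothesis Xgr : forall a t v, gr t v -> gr t.+1 (X a v).
Hypothesis segL : segments X gr L.

Variables (M : lmodType k) (J : finType).
Variables (Y : J -> {linear M -> M}) (grM : nat -> set M).
Variable c : nat -> {linear M -> E}.
Hypothesis fgrM : forall t, findim (grM t).
Hypothesis YgrM : forall b t v, grM t v -> grM t.+1 (Y b v).
Hypothesis c_gr : forall t v i, grM t v -> (i <= t)%N -> gr (t - i) (c i v).
Hypothesis c_out : forall t v i, grM t v -> (t < i)%N -> c i v = 0.
Hypothesis c_sep : forall t, separated c (grM t) t.+1.
Hypothesis c_surj : forall t (u : nat -> E),
  (forall i, (i <= t)%N -> gr (t - i) (u i)) ->
  exists2 v, grM t v & forall i, (i <= t)%N -> c i v = u i.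

(** On sequences of coefficients, [Y b] is [X a] plus a correction of higher
    order. *)
Definition acts (b : J) (a : I) (D : {linear E -> E}) : Prop :=
  forall v, c 0%N (Y b v) = X a (c 0%N v) /\
            forall i, c i.+1 (Y b v) = X a (c i.+1 v) + D (c i v).

(* [Y_acts] controls the growth of the lifted segments from above, [X_acts] and
   [Y_shift] that of an arbitrary subspace of [M] from below. *)
Hypothesis Y_acts : forall b, exists a, exists2 D, acts b a D &
  forall t h, (h <= dim (gr t))%N -> forall v, L t h v -> L t h (D v).
Hypothesis X_acts : forall a, exists b D, acts b a D.
Hypothesis Y_shift : exists b b', forall v, c 0%N (Y b v - Y b' v) = 0 /\
  forall i, c i.+1 (Y b v - Y b' v) = c i v.

Let d s := dim (gr s).
Let g := seg_growth X L.
Let g0 : forall s, g s 0 = 0%N. Proof. by move=> s; exact: seg_growth0 segL s. Qed.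
Let g_mono s i j : (i <= j)%N -> (j <= d s)%N -> (g s i <= g s j)%N.
Proof. exact: (seg_growth_mono fgr Xgr segL). Qed.
Let g_le s j : (j <= d s)%N -> (g s j <= d s.+1)%N.
Proof. exact: (seg_growth_le fgr Xgr segL). Qed.

Lemma sum_dim_rev t : (\sum_(i < t.+1) d (t - i))%N = total_dim d t.
Proof.
rewrite /total_dim (reindex_inj rev_ord_inj) /=; apply: eq_bigr => i _.
by congr d; have := ltn_ord i; lia.
Qed.

Lemma coeff_space (F : nat -> set E) t (V := [set v | grM t v /\
    forall i, (i <= t)%N -> F i (c i v)]) :
  (forall i, (i <= t)%N -> subspace (F i)) ->
  (forall i, (i <= t)%N -> F i `<=` gr (t - i)) ->
  findim V /\ dim V = (\sum_(i < t.+1) dim (F i))%N.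
Proof.
move=> sF Fgr; have sM t' := findim_subspace (fgrM t').
have sV : subspace V.
  split=> [|a u v [Mu Fu] [Mv Fv]].
    split=> [|i it]; first exact: subspace0.
    by rewrite linear0; apply: subspace0; exact: sF.
  split=> [|i it]; first exact: (sM t).2.
  by rewrite linearP; apply: (sF i it).2; [exact: Fu | exact: Fv].
have [fV _ _] : [/\ findim V, (dim V <= dim (grM t))%N & dim V = dim (grM t) -> V = grM t].
  by apply: findim_sub => // v [].
split=> //; rewrite (dim_initial fV (c := c) (m := t.+1)).
  apply: eq_bigr => i _; congr dim; have it : (i <= t)%N by rewrite -ltnS.
  apply/seteqP; split=> [_ [v [[_ Fv] _] <-]|x Fx]; first exact: Fv.
  have [j jt|v Mv vE] := @c_surj t (single i x).
    rewrite /single; case: eqP => [->|_]; first exact: Fgr.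
    by apply: subspace0; exact: findim_subspace.
  exists v; last by rewrite vE // /single eqxx.
  split=> [|j ji]; last by rewrite vE ?(leq_trans (ltnW ji)) // /single ltn_eqF.
  split=> // j jt; rewrite vE // /single; case: eqP => [->|_] //.
  by apply: subspace0; exact: sF.
by move=> v [Mv _]; exact: c_sep Mv.
Qed.

Lemma dim_grM t : dim (grM t) = total_dim d t.
Proof.
have [i _|i _ v|_ dM] := @coeff_space (fun i => gr (t - i)) t.
- exact: findim_subspace.
- by [].
rewrite -(sum_dim_rev t) -[RHS]dM; congr dim; apply/seteqP; split=> [v Mv|v []//].
by split=> // i it; exact: c_gr.
Qed.

Definition lifted t h : set M :=
  [set v | grM t v /\ forall i, (i <= t)%N -> L (t - i) (greedy d g t h i) (c i v)].

Let greedy_d t h i : (h <= dim (grM t))%N -> (i <= t)%N ->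
  (greedy d g t h i <= dim (gr (t - i)))%N.
Proof. by rewrite dim_grM => ht; exact: (greedy_le_dim g0 g_le). Qed.

(** For the stabilised initial spaces [U'], level [i.+1] of the growth contains
    [U' i], and level [0] is the growth of [U' 0]; so the total is at least
    [dim V] plus the growth of [U' 0], whose dimension [top_least] bounds. *)
Lemma growth_bound t (V : set M) : findim V -> V `<=` grM t ->
  (dim V + g t (top_entry d g t (dim V)) <= dim (grow Y V))%N.
Proof.
move=> fV VM; have sV := findim_subspace fV.
have sepV : separated c V t.+1 by move=> v /VM; exact: c_sep.
pose U := initial c V; pose H i := gr (t.+1 - i).
have HX a i v : (i < t.+1)%N -> H i.+1 v -> H i (X a v).
  by rewrite /H => it; rewrite [in X in _ -> X]subSn // subSS; exact: Xgr.
have bU : bounded t.+1 H U.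
  split=> [i|i it _ [v [Vv _] <-]|i it].
  - exact: initial_subspace.
  - by rewrite /H subSS; apply: c_gr; [exact: VM | exact: it].
  apply/seteqP; split=> [_ [v [Vv _] <-]|_ ->].
    by apply: c_out (VM _ Vv) _.
  by apply: subspace0; exact: initial_subspace.
have [U' [bU' stU' sizeU' growU']] := stabilisation XC (fun i => fgr _) HX bU.
have [sU' U'H U'0] := bU'.
have fU' i : findim (U' i) by exact: (bounded_findim (fun i => fgr _) bU').
have sizeV : size_of t.+1 U' = dim V by rewrite sizeU' (dim_initial fV sepV).
have growV : (growth_of X t.+1 U <= dim (grow Y V))%N.
  have fG : findim (grow Y V).
    have sub : grow Y V `<=` grM t.+1.
      by apply: grow_least => [|b v /VM]; [exact/findim_subspace/fgrM | exact: YgrM].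
    by case: (findim_sub (fgrM t.+1) (grow_subspace Y sV) sub).
  have sepG : separated c (grow Y V) t.+2.
    move=> v Gv; apply: c_sep; move: v Gv.
    by apply: grow_least => [|b v /VM]; [exact/findim_subspace/fgrM | exact: YgrM].
  apply: (dim_level_grow_initial sV fG sepG) => [a v Vv|v Vv].
    have [b [D acD]] := X_acts a; have [ac0 acS] := acD v.
    exists (Y b v); first exact: grow_mem.
    have cE i : (forall j, (j < i)%N -> c j v = 0) -> c i (Y b v) = X a (c i v).
      by case: i => [|i] v0 //; rewrite acS (v0 i) // linear0 addr0.
    move=> i v0; split=> [j ji|]; last exact: cE.
    by rewrite cE => [|l lj]; [rewrite v0 // linear0 | apply: v0; exact: ltn_trans ji].
  have [b [b' sh]] := Y_shift; have [sh0 shS] := sh v.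
  exists (Y b v - Y b' v).
    by apply: subspaceB; [exact: grow_subspace | exact: grow_mem | exact: grow_mem].
  by move=> i v0; split=> // -[|j] ji //; rewrite shS v0.
pose v i := dim (U' i).
have vd i : (i <= t)%N -> (v i <= d (t - i))%N.
  move=> it; apply: dim_sub; [exact: fgr | exact: sU' |].
  by have := U'H i; rewrite /H subSS; apply; rewrite ltnS.
have grow_le i : (i <= t)%N -> (g (t - i) (v i) <= dim (grow X (U' i)))%N.
  move=> it; apply: (seg_growth_min fgr Xgr segL) => //.
  by have := U'H i; rewrite /H subSS; apply; rewrite ltnS.
have vg i : (i < t)%N -> (g (t - i.+1) (v i.+1) <= v i)%N.
  move=> it; apply: leq_trans (grow_le _ it) _.
  by apply: dim_sub => //; [exact: grow_subspace | apply: grow_least => // a u; exact: stU'].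
have top_v : (top_entry d g t (dim V) <= v 0)%N.
  by rewrite -sizeV; exact: (top_least g0 vd vg).
have g_top : (g t (top_entry d g t (dim V)) <= g t (v 0))%N.
  by apply: g_mono top_v _; have := vd 0%N isT; rewrite subn0.
apply: leq_trans growV; apply: leq_trans growU'.
rewrite /growth_of big_ord_recl addnC leq_add //.
  apply: leq_trans g_top _; have := grow_le 0%N isT; rewrite subn0 => /leq_trans; apply.
  by [].
rewrite -sizeV; apply: leq_sum => i _; apply: dim_sub => //.
  apply: (findim_level_grow (fun i => fgr _) HX bU').
  by have := ltn_ord i; rewrite !ltnS.
by rewrite lift0; exact: level_grow_shift.
Qed.

Theorem segments_lifted : segments Y grM lifted.
Proof.
have dL := @dim_segment _ _ _ _ _ _ segL.
split.
- move=> t h ht.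
  have [i it|i it|fW dW] := @coeff_space (fun i => L (t - i) (greedy d g t h i)) t.
  + exact/findim_subspace/(findim_segment segL)/greedy_d.
  + exact/(segment_sub segL)/greedy_d.
  split=> //; first by move=> v [].
  rewrite dW -[RHS](@greedy_sum d g g0 g_le t); last by rewrite -dim_grM.
  by apply: eq_bigr => i _; rewrite dL // greedy_d // -ltnS.
- move=> t h h' hh' h't v [Mv Lv]; split=> // i it.
  apply: (segment_mono segL) (Lv i it); last exact: greedy_d.
  exact: greedy_mono.
- move=> t V h' fV VM growV h'd b v [Mv Lv].
  have Vd : (dim V <= dim (grM t))%N.
    by apply: dim_sub VM; [exact: fgrM | exact: findim_subspace].
  have Vt : (dim V <= total_dim d t)%N by rewrite -dim_grM.
  have le := leq_trans (growth_bound fV VM) growV.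
  have gr_growth := greedy_growth g0 g_mono g_le Vt le.
  split=> [|i it]; first exact: YgrM.
  have sL : subspace (L (t.+1 - i) (greedy d g t.+1 h' i)).
    exact/findim_subspace/(findim_segment segL)/greedy_d.
  have [a [D acD LD]] := Y_acts b; have [ac0 acS] := acD v.
  have LX : L (t.+1 - i) (greedy d g t.+1 h' i) (X a (c i v)).
    case: (leqP i t) => i_t; last by rewrite (c_out Mv i_t) linear0; exact: subspace0.
    have := greedy_d h'd it; rewrite subSn // => gd.
    apply: (segmentX segL) (Lv i i_t) => //; first exact: greedy_d.
    by case: (gr_growth i i_t).
  case: i it sL LX => [|i] it sL LX; first by rewrite ac0.
  rewrite acS; apply: subspaceD => //.
  have gd := greedy_d h'd it; rewrite subSS in gd *.
  apply: (segment_mono segL) (LD _ _ _ _ (Lv i it)) => //; last exact: greedy_d.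
  by case: (gr_growth i it).
Qed.

End Transfer.

(** * Segments compatible with a second grading *)

Section HomogeneousSegments.
Variables (k : fieldType) (E : lmodType k) (I : finType).
Variables (X : I -> {linear E -> E}) (gr : nat -> set E) (L : nat -> nat -> set E).
Variables (delta : nat -> {linear E -> E}) (e : I -> nat).
Hypothesis fgr : forall t, findim (gr t).
Hypothesis Xgr : forall a t v, gr t v -> gr t.+1 (X a v).
Hypothesis segL : segments X gr L.
Hypothesis delta_gr : forall t j v, gr t v -> gr t (delta j v).
Hypothesis delta_sep : forall t, separated delta (gr t) t.+1.
Hypothesis delta_orth : forall i j v,
  delta i (delta j v) = if i == j then delta j v else 0.
Hypothesis delta_X : forall a j v, delta (j + e a)%N (X a v) = X a (delta j v).
Hypothesis delta_X0 : forall a j v, (j < e a)%N -> delta j (X a v) = 0.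

(** The space spanned by the forms of lowest degree of the elements of [V], for
    the grading given by the projections [delta]. *)
Definition leading t (V : set E) : set E :=
  [set v | gr t v /\ forall j, initial delta V j (delta j v)].

Lemma leading_subspace t V : subspace V -> subspace (leading t V).
Proof.
move=> sV; have sI j : subspace (initial delta V j) by exact: initial_subspace.
have sG := findim_subspace (fgr t).
split=> [|c u v [Gu Iu] [Gv Iv]].
  by split=> [|j]; rewrite ?linear0; exact: subspace0.
by split=> [|j]; [exact: sG.2 | rewrite linearP; exact: (sI j).2].
Qed.

Lemma leading_delta t V i v : subspace V -> leading t V v -> leading t V (delta i v).
Proof.
move=> sV [Gv Iv]; split=> [|j]; first exact: delta_gr.
by rewrite delta_orth; case: eqP => [->|_] //; apply: subspace0; exact: initial_subspace.
Qed.

Lemma dim_leading t V : findim V -> V `<=` gr t ->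
  findim (leading t V) /\ dim (leading t V) = dim V.
Proof.
move=> fV VG; have sV := findim_subspace fV.
have fL : findim (leading t V).
  by case: (findim_sub (fgr t) (leading_subspace t sV)) => // v [].
split=> //.
have sepV : separated delta V t.+1 by move=> v /VG; exact: delta_sep.
have sepL : separated delta (leading t V) t.+1 by move=> v [+ _]; exact: delta_sep.
rewrite (dim_initial fV sepV) (dim_initial fL sepL); apply: eq_bigr => j _.
congr dim; apply/seteqP; split=> [_ [v [[_ Iv] _] <-] //|x Ix].
have [v [Vv _] vx] := Ix; exists x; last by rewrite -vx delta_orth eqxx.
split=> [|i ij]; last by rewrite -vx delta_orth ltn_eqF.
split=> [|i]; first by rewrite -vx; apply: delta_gr; exact: VG.
rewrite -vx delta_orth; case: eqP => [->|_]; first by rewrite vx.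
by apply: subspace0; exact: initial_subspace.
Qed.

(** Taking lowest forms preserves dimensions and inclusions, and a multiple of a
    lowest form is the lowest form of a multiple when it does not vanish. *)
Lemma segments_leading : segments X gr (fun t h => leading t (L t h)).
Proof.
split=> [t h ht|t h h' hh' h't v [Gv Iv]|t V h' fV VG le h'd a v [Gv Iv]].
- have [||fL dL] := @dim_leading t (L t h); first exact: (findim_segment segL).
    exact: (segment_sub segL).
  split=> //; first by move=> v [].
  by rewrite dL (dim_segment segL).
- split=> // j; apply: initialS (Iv j); exact: (segment_mono segL).
- have Vd : (dim V <= dim (gr t))%N by apply: dim_sub => //; exact: findim_subspace.
  have sL : subspace (L t.+1 h') by exact/findim_subspace/(findim_segment segL).
  split=> [|j]; first exact: Xgr.
  case: (ltnP j (e a)) => ja.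
    by rewrite delta_X0 //; apply: subspace0; exact: initial_subspace.
  have [w [Lw w0] wv] := Iv (j - e a)%N.
  rewrite -{2}(subnK ja) delta_X -wv -delta_X subnK //.
  exists (X a w) => //; split=> [|i ij].
    by case: segL => _ _ LX; exact: (LX t V).
  case: (ltnP i (e a)) => ia; first exact: delta_X0.
  by rewrite -(subnK ia) delta_X w0 ?linear0 //; lia.
Qed.

End HomogeneousSegments.

(** * Polynomials and their quotients *)

Lemma mpoly_span_ind (k : fieldType) n (P : {mpoly k[n]} -> Prop) :
  (forall m, P 'X_[m]) -> P 0 -> (forall c p q, P p -> P q -> P (c *: p + q)) ->
  forall p, P p.
Proof. by move=> PX P0 Plin; elim/mpolyind => // c m p _ _; exact: Plin. Qed.

Lemma pihomogMX (k : fieldType) n (mf : measure n) i (p : {mpoly k[n]}) t :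
  pihomog mf (t + mf U_(i)%MM) ('X_i * p) = 'X_i * pihomog mf t p.
Proof.
elim/mpoly_span_ind: p => [m||c p q IHp IHq].
- rewrite -mpolyXD !pihomogX mfD addnC eqn_add2r.
  by case: ifP => _; rewrite ?mulr0 // mpolyXD.
- by rewrite !linear0 mulr0 linear0.
- by rewrite mulrDr -scalerAr !linearP /= IHp IHq mulrDr -scalerAr.
Qed.

Lemma pihomogMX0 (k : fieldType) n (mf : measure n) i (p : {mpoly k[n]}) t :
  (t < mf U_(i)%MM)%N -> pihomog mf t ('X_i * p) = 0.
Proof.
move=> ti; elim/mpoly_span_ind: p => [m||c p q IHp IHq].
- by rewrite -mpolyXD pihomogX mfD gtn_eqF // ltn_addr.
- by rewrite mulr0 linear0.
- by rewrite mulrDr -scalerAr linearP /= IHp IHq scaler0 addr0.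
Qed.

Lemma mpoly_mul_closed (k : fieldType) n (V : set {mpoly k[n]}) : subspace V ->
  (forall i x, V x -> V ('X_i * x)) -> forall p x, V x -> V (p * x).
Proof.
move=> sV VX; elim/mpoly_span_ind=> [m||c p1 p2 IH1 IH2] x Vx.
- rewrite mpolyXE_id; elim/big_rec: _ => [|i p _ IH]; first by rewrite mul1r.
  elim: (m i) => [|d IHd]; first by rewrite expr0 mul1r.
  by rewrite exprS -!mulrA; apply: VX; rewrite mulrA.
- by rewrite mul0r; exact: subspace0.
- by rewrite mulrDl -scalerAl; apply: sV.2; [exact: IH1 | exact: IH2].
Qed.

Section Projection.
Variables (k : fieldType) (m : nat).

Definition qproj (J : ideal {mpoly k[m]}) (x : {mpoly k[m]}) : quotalg J :=
  \pi_(quotalg J) x.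

Lemma qproj_is_linear J : linear (qproj J).
Proof. by move=> c u v; rewrite /qproj quotalg_piD quotalg_piZ. Qed.

HB.instance Definition _ J := GRing.isLinear.Build k {mpoly k[m]} (quotalg J) _
  (qproj J) (qproj_is_linear J).

Lemma qproj_eq0 J x : qproj J x = 0 <-> x \in J.
Proof.
have -> : 0 = qproj J 0 by rewrite linear0.
by rewrite -[x in x \in J]subr0 -quotalg_eqE; split=> [/eqP|/eqP].
Qed.

Lemma qproj_ind J (P : quotalg J -> Prop) : (forall x, P (qproj J x)) -> forall q, P q.
Proof. by move=> Px q; rewrite -[q]reprK; exact: Px. Qed.

End Projection.

Section Induced.
Variables (k : fieldType) (m n : nat).
Variables (I : ideal {mpoly k[m]}) (I' : ideal {mpoly k[n]}).
Variable f : {linear {mpoly k[m]} -> {mpoly k[n]}}.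

Definition induced of (forall x, x \in I -> f x \in I') : quotalg I -> quotalg I' :=
  fun q => qproj I' (f (repr q)).

Lemma inducedE fI x : induced fI (qproj I x) = qproj I' (f x).
Proof.
apply/eqP; rewrite -subr_eq0 -!linearB; apply/eqP/qproj_eq0/fI.
exact: repr_pi_mod.
Qed.

Lemma induced_is_linear fI : linear (induced fI).
Proof.
move=> c; elim/qproj_ind=> u; elim/qproj_ind=> v.
by rewrite -linearP !inducedE !linearP.
Qed.

HB.instance Definition _ fI := GRing.isLinear.Build k (quotalg I) (quotalg I') _
  (induced fI) (induced_is_linear fI).

End Induced.

Section VariableOperators.
Variables (k : fieldType) (n : nat) (I : ideal {mpoly k[n]}).

Definition mulvar (i : 'I_n) (q : quotalg I) : quotalg I := qproj I 'X_i * q.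

Lemma mulvar_is_linear i : linear (mulvar i).
Proof.
by move=> c u v; rewrite /mulvar mulrDr mulrC -quotalg_scaleAl [u * _]mulrC.
Qed.

HB.instance Definition _ i := GRing.isLinear.Build k (quotalg I) (quotalg I) _
  (mulvar i) (mulvar_is_linear i).

Lemma mulvarE i x : mulvar i (qproj I x) = qproj I ('X_i * x).
Proof. by rewrite /mulvar /qproj quotalg_piM. Qed.

Lemma mulvarC i j q : mulvar i (mulvar j q) = mulvar j (mulvar i q).
Proof. by rewrite /mulvar mulrCA. Qed.

Lemma mul_closed (V : set (quotalg I)) : subspace V ->
  (forall i q, V q -> V (mulvar i q)) -> forall p q, V q -> V (p * q).
Proof.
move=> sV VX; elim/qproj_ind=> p; elim/qproj_ind=> y.
rewrite -quotalg_piM -/(qproj I (p * y)).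
apply: (@mpoly_mul_closed _ _ [set x | V (qproj I x)]) => [|i x] /=; last first.
  by rewrite -mulvarE; exact: VX.
split=> [|c u v Vu Vv] /=; first by rewrite linear0; exact: subspace0.
by rewrite linearP; exact: sV.2.
Qed.

End VariableOperators.

(** * Embeddings and segments *)

Section StdGrading.
Variables (k : fieldType) (n : nat).

Lemma std_grading_subspace t : subspace (@std_grading k n t).
Proof. by split=> [|c u v hu hv]; [exact: rpred0 | exact/rpredD/hv/rpredZ]. Qed.

Lemma findim_std_grading t : findim (@std_grading k n t).
Proof.
pose T : finType := 'X_{1..n < t.+1}.
pose g (c : 'rV[k]_#|T|) : {mpoly k[n]} := \sum_(i < #|T|) c 0 i *: 'X_[enum_val i : T].
have glin : linear g.
  move=> c u v; rewrite /g scaler_sumr -big_split; apply: eq_bigr => i _ /=.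
  by rewrite !mxE scalerDl scalerA.
pose gL := GRing.isLinear.Build _ _ _ _ g glin.
have fg := findim_image (HB.pack_for {linear 'rV[k]_#|T| -> _} g gL).
have sub : @std_grading k n t `<=` range g; last first.
  by case: (findim_sub fg (std_grading_subspace t) sub).
move=> f ft.
exists (\row_i f@_(enum_val i : T)) => //=; rewrite /g.
have tf : (msize f <= t.+1)%N.
  rewrite msizeE; apply/bigmax_leqP_seq => m mf _.
  by rewrite ltnS (dhomog_mf ft mf).
rewrite [RHS](mpolywE tf) (reindex (@enum_val T T)) /=; last first.
  by exists enum_rank => x _; rewrite ?enum_valK ?enum_rankK.
by apply: eq_bigr => i _; rewrite mxE.
Qed.

End StdGrading.

Section GradedQuotient.
Variables (k : fieldType) (n : nat) (I : ideal {mpoly k[n]}).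
Hypothesis hI : homogeneous (@std_grading k n) I.
Local Notation Q := (quotalg I).
Local Notation gr := (@quot_grading k n I).
Local Notation X := (@mulvar k n I).

Lemma homog_ideal t x : x \in I -> pihomog mdeg t x \in I.
Proof.
move=> /hI[s -> sI]; rewrite linear_sum big_seq /=; apply: rpred_sum => y /sI[t' [yI yt']].
have [<-|tt'] := eqVneq t' t; first by rewrite pihomog_dE.
by rewrite (pihomog_ne0 tt' yt') rpred0.
Qed.

Definition qcomp t : {linear Q -> Q} := induced (homog_ideal t).

Lemma qcompE t x : qcomp t (qproj I x) = qproj I (pihomog mdeg t x).
Proof. exact: inducedE. Qed.

Lemma findim_gr t : findim (gr t).
Proof. by case: (rank_nullity (qproj I) (findim_std_grading k n t)). Qed.

Lemma gr_subspace t : subspace (gr t).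
Proof. exact: findim_subspace (findim_gr t). Qed.

Lemma qcomp_gr t q : gr t (qcomp t q).
Proof.
elim/qproj_ind: q => x; rewrite qcompE; exists (pihomog mdeg t x) => //.
exact: pihomogP.
Qed.

Lemma qcomp_id t q : gr t q -> qcomp t q = q.
Proof. by move=> [x xt <-]; rewrite [LHS]qcompE pihomog_dE. Qed.

Lemma qcomp_orth s t q : gr s q -> s != t -> qcomp t q = 0.
Proof.
by move=> [x xs <-] st; rewrite [LHS]qcompE (pihomog_ne0 st xs) linear0.
Qed.

Lemma qcomp_sum q : exists m, q = \sum_(t < m) qcomp t q.
Proof.
elim/qproj_ind: q => x; exists (msize x).
rewrite {1}(pihomog_partitionE (mf := mdeg) (leqnn (msize x))) linear_sum.
by apply: eq_bigr => t _; rewrite qcompE.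
Qed.

Lemma qcomp_mulvar i t q : qcomp t.+1 (X i q) = X i (qcomp t q).
Proof.
elim/qproj_ind: q => x; rewrite mulvarE !qcompE mulvarE.
by rewrite -pihomogMX /= mdeg1 addn1.
Qed.

Lemma qcomp_mulvar0 i q : qcomp 0 (X i q) = 0.
Proof.
by elim/qproj_ind: q => x; rewrite mulvarE qcompE pihomogMX0 /= ?mdeg1 ?linear0.
Qed.

Lemma mulvar_gr i t q : gr t q -> gr t.+1 (X i q).
Proof. by move=> /qcomp_id <-; rewrite -qcomp_mulvar; exact: qcomp_gr. Qed.

Lemma homogeneous_qcomp (J : ideal Q) t q : homogeneous gr J -> q \in J -> qcomp t q \in J.
Proof.
move=> hJ /hJ[s -> sJ]; rewrite linear_sum big_seq /=; apply: rpred_sum => y /sJ[t' [yJ yt']].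
have [tt'|tt'] := eqVneq t' t; first by rewrite -tt' qcomp_id.
by rewrite (qcomp_orth yt' tt') rpred0.
Qed.

Lemma quot_ideal_scale (J : ideal Q) c q : q \in J -> c *: q \in J.
Proof.
suff -> : c *: q = qproj I c%:MP * q by exact: ideal_mull.
by elim/qproj_ind: q => x; rewrite -quotalg_piM mul_mpolyC quotalg_piZ.
Qed.

Lemma component_subspace (J : ideal Q) t : subspace (component gr J t).
Proof.
have sG := gr_subspace t.
split=> [|c u v [uJ ut] [vJ vt]]; first by split; [exact: rpred0 | exact: subspace0].
by split; [apply: rpredD => //; exact: quot_ideal_scale | exact: sG.2].
Qed.

Lemma findim_component (J : ideal Q) t : findim (component gr J t).
Proof.
by case: (findim_sub (findim_gr t) (component_subspace J t)) => // q [].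
Qed.

Section Family.
Variable V : nat -> set Q.
Hypothesis Vgr : forall t, V t `<=` gr t.
Hypothesis sV : forall t, subspace (V t).
Hypothesis VX : forall i t q, V t q -> V t.+1 (X i q).

(** The ideal consists of the elements all of whose components lie in the
    [V t]. *)
Lemma family_ideal : exists J : ideal Q,
  homogeneous gr J /\ forall t, component gr J t = V t.
Proof.
pose S : {pred Q} := fun q => `[< forall t, V t (qcomp t q) >].
have SP q : q \in S <-> forall t, V t (qcomp t q).
  by rewrite unfold_in; split=> /asboolP.
have Ssub : subspace [set q | q \in S].
  split=> [|c u v /SP Su /SP Sv]; first by apply/SP => t; rewrite linear0; exact: subspace0.
  by apply/SP => t; rewrite linearP; apply: (sV t).2.
have SX i q : q \in S -> X i q \in S.
  move=> /SP Sq; apply/SP => -[|t]; first by rewrite qcomp_mulvar0; exact: subspace0.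
  by rewrite qcomp_mulvar; exact: VX.
have Szmod : zmod_closed S.
  by split=> [|u v Su Sv]; [exact: (subspace0 Ssub) | exact: (subspaceB Ssub)].
have Smul a : {in S, forall u, a * u \in S}.
  by move=> u Su; exact: (mul_closed Ssub SX).
pose zC := GRing.isZmodClosed.Build Q S Szmod.
pose mS := isMulStable.Build Q S Smul.
pose J : ideal Q := HB.pack_for (ideal Q) S zC mS.
have JP q : q \in J <-> forall t, V t (qcomp t q) by exact: SP.
exists J; split=> [q qJ|t].
  have [m qE] := qcomp_sum q.
  exists [seq qcomp t q | t <- iota 0 m].
    by rewrite big_map {1}qE -(big_mkord xpredT (fun t => qcomp t q)) /index_iota subn0.
  move=> _ /mapP[t _ ->]; exists t; split; last exact: qcomp_gr.
  apply/JP => s; have [<-|ts] := eqVneq t s.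
    by rewrite (qcomp_id (qcomp_gr t q)); exact: ((JP q).1 qJ).
  by rewrite (qcomp_orth (qcomp_gr t q) ts); exact: subspace0.
apply/seteqP; split=> [q [/JP/(_ t) + /qcomp_id qt]|q Vq]; first by rewrite qt.
split; last exact: Vgr.
apply/JP => s; have [<-|ts] := eqVneq t s; first by rewrite qcomp_id //; exact: Vgr.
by rewrite (qcomp_orth (Vgr Vq) ts); exact: subspace0.
Qed.

Lemma hilbert_set_family : hilbert_set I (fun t => (dim (V t))%:Z).
Proof.
have [J [hJ JV]] := family_ideal; exists J => //; apply/funext => t.
by rewrite /hilbert_series JV.
Qed.

End Family.

Lemma component_mulvar (J : ideal Q) t i q :
  component gr J t q -> component gr J t.+1 (X i q).
Proof. by move=> [qJ qt]; split; [exact: ideal_mull | exact: mulvar_gr]. Qed.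

Section EmbeddingToSegments.
Variable eps : int_series -> ideal Q.
Hypothesis eps_embedding : is_embedding eps.

(** The Hilbert series of the sum of a subspace of dimension [h] in degree [t]
    and of all components of higher degree. *)
Definition top_series t h : int_series := fun s =>
  ((if (s < t)%N then 0 else if s == t then h else dim (gr s))%N)%:Z.

Definition eps_segment t h : set Q := component gr (eps (top_series t h)) t.

Lemma hilbert_top_series t h : (h <= dim (gr t))%N -> hilbert_set I (top_series t h).
Proof.
move=> /(exists_subspace (findim_gr t))[U [fU UG dU]].
pose V s : set Q := if (s < t)%N then [set 0] else if s == t then U else gr s.
have -> : top_series t h = fun s => (dim (V s))%:Z.
  apply/funext => s; rewrite /top_series /V; case: ifP => _; first by rewrite dim0.
  by case: ifP => // _; rewrite dU.
apply: hilbert_set_family => [s|s|i s q]; rewrite /V.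
- case: ifP => _; first by move=> _ ->; apply: subspace0; exact: gr_subspace.
  by case: eqP => [->|_].
- case: ifP => _; first exact: subspace_zero.
  by case: ifP => _; [exact: findim_subspace | exact: gr_subspace].
- case: (ltngtP s t) => [st|st|->].
  + move=> ->; rewrite linear0; case: ifP => _; first by [].
    by case: ifP => _; apply: subspace0; [exact: findim_subspace | exact: gr_subspace].
  + by rewrite ltnNge (leqW (ltnW st)) /= gtn_eqF ?ltnS ?(ltnW st) //; exact: mulvar_gr.
  + by rewrite ltnNge leqnSn /= gtn_eqF // => /UG; exact: mulvar_gr.
Qed.

Lemma eps_dim F t : hilbert_set I F -> (dim (component gr (eps F) t))%:Z = F t.
Proof. by case: eps_embedding => _ _ _ epsF /epsF {2}<-. Qed.

Lemma eps_sub F G t : hilbert_set I F -> hilbert_set I G -> le_series F G ->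
  component gr (eps F) t `<=` component gr (eps G) t.
Proof.
case: eps_embedding => _ mono _ _ hF hG FG q [qF qt].
by split=> //; exact: mono FG _ qF.
Qed.

Lemma eps_component_eq F G t : hilbert_set I F -> hilbert_set I G ->
  le_series F G -> F t = G t -> component gr (eps F) t = component gr (eps G) t.
Proof.
move=> hF hG FG FGt; apply: dim_sub_eq.
- exact: findim_component.
- exact: component_subspace.
- exact: eps_sub.
by rewrite -lez_nat !eps_dim // FGt.
Qed.

(** Let [F] be the series of the ideal that is [V] in degree [t], the growth of
    [V] in degree [t.+1], and everything above.  It lies between the top series
    of the growth of [V] and that of [V], and agrees with the former in degree
    [t.+1] and with the latter in degree [t].  Hence [eps F] is a segment in both
    degrees, and being an ideal it carries the growth condition. *)
Lemma segments_of_embedding : segments X gr eps_segment.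
Proof.
have top_self t h : top_series t h t = h%:Z by rewrite /top_series ltnn eqxx.
split=> [t h ht|t h h' hh' h't|t V h' fV VG le h'd i q Lq].
- have hS := hilbert_top_series ht.
  split; [exact: findim_component | by move=> q [] |].
  by apply/eqP; rewrite -eqz_nat eps_dim // top_self.
- have hS := hilbert_top_series (leq_trans hh' h't).
  apply: (eps_sub hS (hilbert_top_series h't)) => s; rewrite /top_series lez_nat.
  by case: ifP => // _; case: ifP.
have Vd : (dim V <= dim (gr t))%N.
  by apply: dim_sub => //; [exact: findim_gr | exact: findim_subspace].
have [fG GG Gd] := findim_grow findim_gr mulvar_gr fV VG.
pose K s : set Q := if (s < t)%N then [set 0] else if s == t then V else
  if s == t.+1 then grow X V else gr s.
pose F : int_series := fun s => (dim (K s))%:Z.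
have hF : hilbert_set I F.
  apply: hilbert_set_family => [s|s|j s v]; rewrite /K.
  - case: ifP => _; first by move=> _ ->; apply: subspace0; exact: gr_subspace.
    by case: eqP => [->|_] //; case: eqP => [->|_].
  - case: ifP => _; first exact: subspace_zero.
    case: ifP => _; first exact: findim_subspace.
    by case: ifP => _; [exact: findim_subspace | exact: gr_subspace].
  - case: (ltngtP s t) => [st|st|->].
    + move=> ->; rewrite linear0; case: ifP => _; first by [].
      case: ifP => _; first by apply: subspace0; exact: findim_subspace.
      by case: ifP => _; apply: subspace0; [exact: findim_subspace | exact: gr_subspace].
    + have -> : (s.+1 < t)%N = false by lia.
      have -> : (s.+1 == t) = false by lia.
      have -> : (s.+1 == t.+1) = false by lia.
      by case: ifP => [/eqP -> /GG|_]; exact: mulvar_gr.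
    + rewrite ltnNge leqnSn /= gtn_eqF // eqxx => Vv.
      by apply: grow_mem => //; exact: findim_subspace.
have F_le : le_series F (top_series t (dim V)).
  move=> s; rewrite /F /K /top_series; case: ifP => _; first by rewrite dim0.
  by case: eqP => [//|_]; case: eqP => [->|//]; rewrite lez_nat.
have top_le_F : le_series (top_series t.+1 (dim (grow X V))) F.
  move=> s; rewrite /F /K /top_series ltnS leq_eqVlt.
  by case: (ltngtP s t) => //= _; case: ifP.
have Fh := eps_component_eq hF (hilbert_top_series Vd) F_le (t := t).
rewrite /eps_segment -Fh in Lq; last by rewrite top_self /F /K ltnn eqxx.
have := component_mulvar i Lq.
have hG := hilbert_top_series Gd.
have <- := eps_component_eq hG hF top_le_F (t := t.+1); last first.
  by rewrite top_self /F /K ltnNge leqnSn /= gtn_eqF // eqxx.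
apply: eps_sub => //; first exact: hilbert_top_series.
by move=> s; rewrite /top_series lez_nat; case: ifP => // _; case: ifP.
Qed.

End EmbeddingToSegments.

Section SegmentsToEmbedding.
Variable L : nat -> nat -> set Q.
Hypothesis segL : segments X gr L.

(** [F] is sent to the sum of the [L t (F t)].  This is an ideal because [F] is
    the Hilbert series of some ideal [J], whose components grow at least as much
    as the segments of the same dimension. *)
Lemma embedding_of_segments : quot_admits_embedding I.
Proof.
have comp_le (J : ideal Q) t : (dim (component gr J t) <= dim (gr t))%N.
  by apply: dim_sub; [exact: findim_gr | exact: component_subspace | move=> q []].
have hilbE F : hilbert_set I F -> forall t, (`|F t| <= dim (gr t))%N /\ F t = `|F t|%N.
  by move=> [J _ <-] t; rewrite /hilbert_series absz_nat.
have /choice[eps epsP] : forall F : int_series, exists J : ideal Q, hilbert_set I F ->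
    homogeneous gr J /\ forall t, component gr J t = L t `|F t|%N.
  move=> F; have [hF|nF] := pselect (hilbert_set I F); last first.
    by exists (Ideal.clone Q (ideal_gen (set0 : set Q)) _).
  have le t := (hilbE F hF t).1.
  have [|t|i t q Lq|J JP] := @family_ideal (fun t => L t `|F t|%N).
  - by move=> t; exact: (segment_sub segL).
  - exact/findim_subspace/(findim_segment segL).
  - have [J hJ JF] := hF; have [_ _ LX] := segL.
    have Fd s : `|F s|%N = dim (component gr J s) by rewrite -JF absz_nat.
    apply: (LX t (component gr J t)) => //; last by rewrite -Fd.
    + exact: findim_component.
    + by move=> v [].
    + rewrite Fd; apply: dim_sub.
      * exact: findim_component.
      * exact/grow_subspace/component_subspace.
      * apply: grow_least; first exact: component_subspace.
        by move=> j v; exact: component_mulvar.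
  - by exists J.
have dimL F t : hilbert_set I F -> dim (component gr (eps F) t) = `|F t|%N.
  by move=> hF; rewrite (epsP F hF).2 (dim_segment segL) //; case: (hilbE F hF t).
exists eps; split.
- by move=> F hF; case: (epsP F hF).
- move=> F G hF hG FG q qF; have [m ->] := qcomp_sum q.
  rewrite rpred_sum // => t _.
  suff : component gr (eps G) t (qcomp t q) by case.
  have : component gr (eps F) t (qcomp t q).
    by split; [apply: homogeneous_qcomp qF; case: (epsP F hF) | exact: qcomp_gr].
  rewrite (epsP F hF).2 (epsP G hG).2; apply: (segment_mono segL).
    by have := FG t; rewrite (hilbE F hF t).2 (hilbE G hG t).2.
  exact: (hilbE G hG t).1.
- move=> F G hF hG FG; apply/funext => t.
  rewrite (hilbE F hF t).2 (hilbE G hG t).2 -!dimL //; congr (dim _)%:Z.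
  by apply/seteqP; split=> q [qe qt]; split; rewrite // ?FG // -FG.
- move=> F hF; apply/funext => t.
  by rewrite /hilbert_series dimL // -(hilbE F hF t).2.
Qed.

End SegmentsToEmbedding.

End GradedQuotient.

(** * Division by y - z *)

Section Polarize.
Variables (k : fieldType) (n d : nat).
Hypothesis d_gt0 : (0 < d)%N.
Local Notation A := {mpoly k[n.+1]}.
Local Notation B := {mpoly k[n.+2]}.
Local Notation y := (@ord_max n).
Local Notation z := (@ord_max n.+1).
Local Notation wid := (widen_ord (leqnSn n.+1)).

Definition ydeg (m : 'X_{1..n.+1}) : nat := m y.

Lemma ydeg0 : ydeg 0%MM = 0%N. Proof. exact: mnm0E. Qed.
Lemma ydegD : {morph ydeg : m1 m2 / (m1 + m2)%MM >-> (m1 + m2)%N}.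
Proof. by move=> m1 m2; exact: mnmDE. Qed.
HB.instance Definition _ := isMeasure.Build n.+1 ydeg ydeg0 ydegD.

Definition identify_vars : n.+2.-tuple A :=
  [tuple 'X_(inord (minn i n)) | i < n.+2].

(** The algebra map [z |-> y]. *)
Definition depolarize : B -> A := comp_mpoly identify_vars.

HB.instance Definition _ := GRing.Linear.on depolarize.
HB.instance Definition _ := GRing.RMorphism.on depolarize.

Lemma depolarize_wid i : depolarize 'X_(wid i) = 'X_i.
Proof.
rewrite /depolarize comp_mpolyXU -tnth_nth tnth_mktuple /=; congr ('X_ _).
by apply: val_inj; rewrite /= inordK (minn_idPl _) // -ltnS.
Qed.

Lemma depolarize_z : depolarize 'X_z = 'X_y.
Proof.
rewrite /depolarize comp_mpolyXU -tnth_nth tnth_mktuple /=; congr ('X_ _).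
by apply: val_inj; rewrite /= inordK (minn_idPr _).
Qed.

Lemma depolarize_mwiden f : depolarize (mwiden f) = f.
Proof.
elim/mpoly_span_ind: f => [m||c f g IHf IHg].
- rewrite mpolyXE_id rmorph_prod rmorph_prod /=; apply: eq_bigr => i _.
  by rewrite !rmorphXn /= mwidenX mnmwiden1 depolarize_wid.
- by rewrite mwiden0 linear0.
- by rewrite mwidenD mwidenZ linearP /= IHf IHg.
Qed.

Definition ell : B := 'X_(wid y) - 'X_z.

Lemma depolarize_ell : depolarize ell = 0.
Proof. by rewrite linearB /= depolarize_wid depolarize_z subrr. Qed.

Lemma ell_neq0 : ell != 0.
Proof.
have zy : (z == wid y) = false by apply/eqP => /(congr1 val) /=; lia.
have zyU : (U_(z) == U_(wid y) :> 'X_{1..n.+2})%MM = false.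
  by apply/eqP => /(congr1 (fun m : 'X_{1..n.+2} => m (wid y))); rewrite !mnm1E eqxx zy.
rewrite subr_eq0; apply/eqP => /(congr1 (mcoeff U_(wid y)))/eqP.
by rewrite !mcoeffX eqxx zyU oner_eq0.
Qed.

Lemma polarize_mnmX m i : i != y ->
  polarize_mnm d (U_(i) + m)%MM = (U_(wid i) + polarize_mnm d m)%MM.
Proof.
move=> iy; rewrite /polarize_mnm mnmDE mnm1E (negbTE iy) add0n.
case: ifP => _; first by rewrite mnmwidenD mnmwiden1.
rewrite addmA -mnmwiden1 -mnmwidenD; congr (mnmwiden _ + _)%MM.
apply/mnmP => j; rewrite !(mnmDE, mnmBE, mnm1E).
by case: (eqVneq y j) => [<-|_]; rewrite ?(negbTE iy) ?subn0.
Qed.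

Lemma polarizeMX i (f : A) : i != y ->
  polarize d ('X_i * f) = 'X_(wid i) * polarize d f.
Proof.
move=> iy; elim/mpoly_span_ind: f => [m||c f g IHf IHg].
- by rewrite -mpolyXD !polarizeX polarize_mnmX // mpolyXD.
- by rewrite mulr0 !linear0 mulr0.
- by rewrite mulrDr -scalerAr !linearP /= IHf IHg mulrDr -scalerAr.
Qed.

(** The monomials [m] on which polarization commutes with [y] are those of
    degree other than [d - 1] in [y]; in that degree [y m] is polarized to
    [z m], which differs from [y m] by [ell m]. *)
Lemma polarizeMy (f : A) :
  'X_(wid y) * polarize d f =
  polarize d ('X_y * f) + ell * polarize d (pihomog ydeg d.-1 f).
Proof.
elim/mpoly_span_ind: f => [m||c f g IHf IHg].
- rewrite -mpolyXD pihomogX !polarizeX /polarize_mnm mnmDE mnm1E eqxx add1n /= /ydeg.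
  case: (ltngtP (m y) d.-1) => my.
  + have -> : (m y < d)%N by lia. have -> : ((m y).+1 < d)%N by lia.
    by rewrite linear0 mulr0 addr0 mnmwidenD mnmwiden1 mpolyXD.
  + have -> : (m y < d)%N = false by lia. have -> : ((m y).+1 < d)%N = false by lia.
    rewrite linear0 mulr0 addr0 -mpolyXD addmA -mnmwiden1 -mnmwidenD.
    congr 'X_[mnmwiden _ + _]; apply/mnmP => j; rewrite !(mnmDE, mnmBE, mnm1E).
    by case: eqP => [<-|_]; lia.
  + have -> : (m y < d)%N by lia. have -> : ((m y).+1 < d)%N = false by lia.
    rewrite polarizeX /polarize_mnm; have -> : (m y < d)%N by lia.
    have -> : (U_(y) + m - U_(y) = m)%MM by rewrite addmC addmK.
    by rewrite mpolyXD /ell mulrBl [_ * 'X_z]mulrC addrC subrK.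
- by rewrite mulr0 !linear0 mulr0 mulr0 addr0.
- rewrite [pihomog _ _ _]linearP ['X_y * _]mulrDr -scalerAr !linearP /=.
  rewrite !mulrDr -!scalerAr addrACA -scalerDr -IHf -IHg.
  by [].
Qed.

Lemma mdeg_polarize_mnm (m : 'X_{1..n.+1}) : mdeg (polarize_mnm d m) = mdeg m.
Proof.
have mdeg_wid (m' : 'X_{1..n.+1}) : mdeg (mnmwiden m') = mdeg m'.
  rewrite !mdegE big_ord_recr /= mnmwiden_ordmax addn0.
  by apply: eq_bigr => i _; rewrite mnmwiden_widen.
rewrite /polarize_mnm; case: ltnP => dm; first exact: mdeg_wid.
have mE : (m - U_(y) + U_(y))%MM = m.
  by apply/submK/mnm_lepP => i; rewrite mnm1E; case: eqP => [<-|//]; exact: leq_trans dm.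
by rewrite -[RHS](congr1 (@mdeg _) mE) !mdegD !mdeg1 mdeg_wid.
Qed.

Lemma pihomog_polarize t (f : A) :
  pihomog mdeg t (polarize d f) = polarize d (pihomog mdeg t f).
Proof.
elim/mpoly_span_ind: f => [m||c f g IHf IHg].
- rewrite polarizeX !pihomogX /= mdeg_polarize_mnm.
  by case: ifP => _; rewrite ?linear0 // polarizeX.
- by rewrite !linear0.
- by rewrite !linearP /= IHf IHg.
Qed.

Lemma depolarize_polarize (f : A) : depolarize (polarize d f) = f.
Proof.
elim/mpoly_span_ind: f => [m||c f g IHf IHg].
- rewrite polarizeX /polarize_mnm; case: ltnP => dm.
    by rewrite -mwidenX depolarize_mwiden.
  rewrite mpolyXD rmorphM /= -mwidenX depolarize_mwiden depolarize_z -mpolyXD submK //.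
  by apply/mnm_lepP => i; rewrite mnm1E; case: eqP => [<-|//]; exact: leq_trans dm.
- by rewrite !linear0.
- by rewrite !linearP /= IHf IHg.
Qed.

(** The identity and the endomorphism [z |-> y] agree modulo [ell] on the
    variables, hence everywhere. *)
Lemma mwiden_depolarize (f : B) : exists q, f = mwiden (depolarize f) + ell * q.
Proof.
have mwidenP c (u v : A) : mwiden (c *: u + v) = c *: mwiden u + mwiden v.
  by rewrite mwidenD mwidenZ.
elim/mpoly_span_ind: f => [m||c f g [qf IHf] [qg IHg]]; last first.
- exists (c *: qf + qg); rewrite linearP /= mwidenP mulrDr -scalerAr addrACA -scalerDr.
  by rewrite -IHf -IHg.
- by exists 0; rewrite linear0 mwiden0 mulr0 addr0.
have mulP (f g : B) : (exists q, f = mwiden (depolarize f) + ell * q) ->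
    (exists q, g = mwiden (depolarize g) + ell * q) ->
    exists q, f * g = mwiden (depolarize (f * g)) + ell * q.
  move=> [qf IHf] [qg IHg]; set F := mwiden _ in IHf; set G := mwiden _ in IHg.
  exists (qf * (G + ell * qg) + F * qg).
  have -> : mwiden (depolarize (f * g)) = F * G by rewrite !rmorphM.
  rewrite -IHg {1}IHf mulrDl {1}IHg mulrDr -addrA mulrDr; congr (_ + _).
  by rewrite addrC [F * (ell * _)]mulrCA -mulrA.
rewrite mpolyXE_id; elim/big_rec: _ => [|i f _ IH].
  by exists 0; rewrite !rmorph1 mulr0 addr0.
apply: (mulP _ _) => //; elim: (m i) => [|e IHe].
  by exists 0; rewrite expr0 !rmorph1 mulr0 addr0.
rewrite exprS; apply: (mulP _ _) => //.
have [j ->|->] := unliftP ord_max i.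
  have -> : lift ord_max j = wid j by apply: val_inj; rewrite /= /bump leqNgt ltn_ord.
  by exists 0; rewrite mulr0 addr0 depolarize_wid mwidenX mnmwiden1.
exists (- 1); rewrite depolarize_z mwidenX mnmwiden1 mulrN1 /ell opprB addrC subrK.
by [].
Qed.

Lemma ell_division (f : B) : exists q, f = polarize d (depolarize f) + ell * q.
Proof.
have [q fq] := mwiden_depolarize f.
have [q' pq'] := mwiden_depolarize (polarize d (depolarize f)).
exists (q - q'); rewrite mulrBr addrA {1}fq {1}pq' depolarize_polarize.
by rewrite addrAC -[_ + _ - _]addrA subrr addr0.
Qed.

Definition ell_quot (f : B) : B := projT1 (cid (ell_division f)).

Lemma ell_quotE f : f = polarize d (depolarize f) + ell * ell_quot f.
Proof. by rewrite /ell_quot; case: cid. Qed.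

(** [polarize d] is a section of [depolarize], which kills [ell]. *)
Lemma ell_quot_unique f r q : f = polarize d r + ell * q ->
  depolarize f = r /\ ell_quot f = q.
Proof.
move=> fE; have rE : depolarize f = r.
  rewrite fE linearD /= depolarize_polarize rmorphM /= depolarize_ell.
  by rewrite mul0r addr0.
split=> //; apply: (mulfI ell_neq0); have := ell_quotE f.
by rewrite rE {1}fE => /addrI.
Qed.

Lemma ell_quot_is_linear : linear ell_quot.
Proof.
move=> c f g; have [|_ //] := @ell_quot_unique (c *: f + g)
  (c *: depolarize f + depolarize g) (c *: ell_quot f + ell_quot g).
by rewrite linearP mulrDr -scalerAr addrACA -scalerDr -!ell_quotE.
Qed.

HB.instance Definition _ := GRing.isLinear.Build k B B _ ell_quot ell_quot_is_linear.

Lemma ell_quot_polarize r : ell_quot (polarize d r) = 0.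
Proof.
by have [|_ //] := @ell_quot_unique (polarize d r) r 0; rewrite mulr0 addr0.
Qed.

Lemma ell_quotMell q : depolarize (ell * q) = 0 /\ ell_quot (ell * q) = q.
Proof. by apply: ell_quot_unique; rewrite linear0 add0r. Qed.

Lemma ell_quotMX i f : i != y ->
  depolarize ('X_(wid i) * f) = 'X_i * depolarize f /\
  ell_quot ('X_(wid i) * f) = 'X_(wid i) * ell_quot f.
Proof.
move=> iy; apply: ell_quot_unique.
by rewrite {1}[f]ell_quotE mulrDr -polarizeMX // mulrCA.
Qed.

Lemma ell_quotMy f :
  depolarize ('X_(wid y) * f) = 'X_y * depolarize f /\
  ell_quot ('X_(wid y) * f) =
    polarize d (pihomog ydeg d.-1 (depolarize f)) + 'X_(wid y) * ell_quot f.
Proof.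
apply: ell_quot_unique.
by rewrite {1}[f]ell_quotE mulrDr polarizeMy mulrDr addrA [ell * (_ * _)]mulrCA.
Qed.

Lemma var_cases (P : 'I_n.+2 -> Prop) :
  (forall i : 'I_n.+1, i != y -> P (wid i)) -> P (wid y) -> P z -> forall i, P i.
Proof.
move=> Px Py Pz i; have [j ->|-> //] := unliftP ord_max i.
have -> : lift ord_max j = wid j by apply: val_inj; rewrite /= /bump leqNgt ltn_ord.
by have [->|jy] := eqVneq j y; [exact: Py | exact: Px].
Qed.

Lemma pihomog_depolarize t (f : B) :
  pihomog mdeg t (depolarize f) = depolarize (pihomog mdeg t f).
Proof.
pose V : set B := [set f | forall t, pihomog mdeg t (depolarize f) =
                                     depolarize (pihomog mdeg t f)].
have sV : subspace V.
  by split=> [s|c u v Vu Vv s]; rewrite ?linear0 // !linearP /= Vu Vv.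
suff : V (f * 1) by rewrite mulr1; apply.
apply: (mpoly_mul_closed sV) => [i g Vg|s]; last first.
  have pi1 m : pihomog mdeg s (1 : {mpoly k[m]}) = if 0%N == s then 1 else 0.
    by rewrite -mpolyX0 pihomogX /= mdeg0.
  by rewrite rmorph1 !pi1; case: ifP => _; rewrite ?rmorph1 ?linear0.
have [j jE] : exists j, depolarize 'X_i = 'X_j.
  elim/var_cases: i => [j _||]; [exists j | exists y | exists y].
  - exact: depolarize_wid.
  - exact: depolarize_wid.
  - exact: depolarize_z.
case=> [|s]; first by rewrite rmorphM /= jE !pihomogMX0 /= ?mdeg1 // linear0.
have degX m (i' : 'I_m) (h : {mpoly k[m]}) :
    pihomog mdeg s.+1 ('X_i' * h) = 'X_i' * pihomog mdeg s h.
  by rewrite -pihomogMX /= mdeg1 addn1.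
by rewrite rmorphM /= jE !degX rmorphM /= jE Vg.
Qed.

Lemma pihomogMell t (q : B) :
  pihomog mdeg t.+1 (ell * q) = ell * pihomog mdeg t q /\
  pihomog mdeg 0 (ell * q) = 0.
Proof.
have degX (i : 'I_n.+2) : pihomog mdeg t.+1 ('X_i * q) = 'X_i * pihomog mdeg t q.
  by rewrite -pihomogMX /= mdeg1 addn1.
split; rewrite /ell mulrBl linearB /=; first by rewrite !degX -mulrBl.
by rewrite !pihomogMX0 /= ?mdeg1 // subr0.
Qed.

Lemma ell_quot_homog t (f : B) : f \is t.+1.-homog -> ell_quot f \is t.-homog.
Proof.
move=> ft; rewrite homog_piE; apply/eqP.
have [|_ //] := @ell_quot_unique f (depolarize f) (pihomog mdeg t (ell_quot f)).
rewrite -{1}(pihomog_dE ft) {1}(ell_quotE f) linearD /= (pihomogMell _ _).1.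
by rewrite pihomog_polarize pihomog_depolarize (pihomog_dE ft).
Qed.

Lemma ell_quot_homog0 (f : B) : f \is 0.-homog -> ell_quot f = 0.
Proof.
move=> f0; have [|_ //] := @ell_quot_unique f (depolarize f) 0.
rewrite mulr0 addr0 -{1}(pihomog_dE f0) {1}(ell_quotE f) linearD /= (pihomogMell 0 _).2.
by rewrite pihomog_polarize pihomog_depolarize (pihomog_dE f0) addr0.
Qed.

(** The coefficients of the expansion of [f] as a sum of [ell^i * polarize d r]. *)
Definition coef i (f : B) : A := depolarize (iter i ell_quot f).

Lemma coef_is_linear i : linear (coef i).
Proof.
move=> c f g; rewrite /coef; elim: i f g => [|i IH] f g; first exact: linearP.
by rewrite !iterSr linearP; exact: IH.
Qed.

HB.instance Definition _ i := GRing.isLinear.Build k B A _ (coef i) (coef_is_linear i).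

Lemma coefS i f : coef i.+1 f = coef i (ell_quot f).
Proof. by rewrite /coef iterSr. Qed.

Lemma coefMX i j f : j != y -> coef i ('X_(wid j) * f) = 'X_j * coef i f.
Proof.
move=> jy; elim: i f => [|i IH] f; first by case: (ell_quotMX f jy).
by rewrite !coefS (ell_quotMX f jy).2 IH.
Qed.

Lemma coef_polarize i r : coef i.+1 (polarize d r) = 0.
Proof. by rewrite coefS ell_quot_polarize linear0. Qed.

Lemma coefMy i f : coef i.+1 ('X_(wid y) * f) =
  'X_y * coef i.+1 f + pihomog ydeg d.-1 (coef i f).
Proof.
elim: i f => [|i IH] f; rewrite coefS (ell_quotMy f).2 linearD /=.
  by rewrite /coef /= depolarize_polarize (ell_quotMy _).1 addrC.
by rewrite coef_polarize add0r IH !coefS.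
Qed.

Lemma coefMell f : coef 0 (ell * f) = 0 /\ forall i, coef i.+1 (ell * f) = coef i f.
Proof.
by split=> [|i]; rewrite ?coefS ?(ell_quotMell f).2 //; exact: (ell_quotMell f).1.
Qed.

Lemma coefMz f : coef 0 ('X_z * f) = 'X_y * coef 0 f /\
  forall i, coef i.+1 ('X_z * f) =
    'X_y * coef i.+1 f + (pihomog ydeg d.-1 (coef i f) - coef i f).
Proof.
have zE : 'X_z * f = 'X_(wid y) * f - ell * f by rewrite -mulrBl /ell opprB addrC subrK.
rewrite zE; split=> [|i]; rewrite linearB /=.
  by rewrite (coefMell f).1 subr0 [coef 0 _](ell_quotMy f).1.
by rewrite (coefMell f).2 coefMy addrA.
Qed.

Lemma coef_homog t i (f : B) : f \is t.-homog -> (i <= t)%N ->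
  coef i f \is (t - i).-homog.
Proof.
elim: i t f => [|i IH] t f ft it.
  by rewrite subn0 homog_piE pihomog_depolarize (pihomog_dE ft).
case: t ft it => // t ft it; rewrite subSS coefS.
by apply: IH => //; exact: ell_quot_homog.
Qed.

Lemma coef_out t i (f : B) : f \is t.-homog -> (t < i)%N -> coef i f = 0.
Proof.
elim: i t f => // i IH [|t] f ft ti; rewrite coefS; last exact/IH/ti/ell_quot_homog.
by rewrite ell_quot_homog0 // linear0.
Qed.

Lemma ell_homog : ell \is 1.-homog.
Proof. by apply: rpredB; rewrite dhomogX /= mdeg1. Qed.

Lemma polarize_homog t (f : A) : f \is t.-homog -> polarize d f \is t.-homog.
Proof. by move=> ft; rewrite homog_piE pihomog_polarize (pihomog_dE ft). Qed.

Lemma coef_surj t (u : nat -> A) : (forall i, (i <= t)%N -> u i \is (t - i).-homog) ->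
  exists2 f : B, f \is t.-homog & forall i, (i <= t)%N -> coef i f = u i.
Proof.
elim: t u => [|t IH] u hu.
  exists (polarize d (u 0%N)); first exact/polarize_homog/hu.
  by case=> // _; exact: depolarize_polarize.
have [i it|f ft fu] := IH (fun i => u i.+1); first exact: (hu i.+1).
exists (polarize d (u 0%N) + ell * f).
  apply: rpredD; first exact: (polarize_homog (hu 0%N isT)).
  by have := dhomogM ell_homog ft; rewrite add1n.
case=> [|i] it; rewrite linearD /=.
  by rewrite (coefMell f).1 addr0; exact: depolarize_polarize.
by rewrite coef_polarize add0r (coefMell f).2 fu.
Qed.

End Polarize.

(** * The quotient by the polarized ideal *)

Section PolarizedQuotient.
Variables (k : fieldType) (n d : nat) (a : ideal {mpoly k[n.+1]}).
Hypothesis ha : homogeneous (@bigrading k n) a.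
Hypothesis d_gt0 : (0 < d)%N.
Local Notation A := {mpoly k[n.+1]}.
Local Notation B := {mpoly k[n.+2]}.
Local Notation y := (@ord_max n).
Local Notation z := (@ord_max n.+1).
Local Notation wid := (widen_ord (leqnSn n.+1)).
Local Notation J := (polarized_ideal d a).
Local Notation c := (coef d_gt0).
Local Notation ydeg := (@ydeg n).

Lemma bigrading_std_homog uv (f : A) : bigrading uv f -> f \is (uv.1 + uv.2).-homog.
Proof.
move=> fuv; apply/dhomogP => m /fuv[mx my].
rewrite /= mdegE big_ord_recr /= my; congr (_ + _)%N; rewrite -mx.
by apply: eq_bigr => i _; congr (m _); exact: val_inj.
Qed.

Lemma bigrading_ydeg_homog uv (f : A) : bigrading uv f -> f \is uv.2.-homog for ydeg.
Proof. by move=> fuv; apply/dhomogP => m /fuv[]. Qed.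

Lemma homogeneous_std : homogeneous (@std_grading k n.+1) a.
Proof.
move=> x /ha[s -> sa]; exists s => // f /sa[uv [fa fuv]].
by exists (uv.1 + uv.2)%N; split=> //; exact: bigrading_std_homog.
Qed.

Lemma ydeg_ideal j x : x \in a -> pihomog ydeg j x \in a.
Proof.
move=> /ha[s -> sa]; rewrite linear_sum big_seq /=; apply: rpred_sum => f.
move=> /sa[uv [fa /bigrading_ydeg_homog fuv]].
have [<-|jv] := eqVneq uv.2 j; first by rewrite pihomog_dE.
by rewrite (pihomog_ne0 jv fuv) rpred0.
Qed.

Lemma polarize_mem r : r \in a -> polarize d r \in J.
Proof.
move=> ra; apply/ideal_genP; exists [:: (1, polarize d r)].
  by move=> u; rewrite inE => /eqP ->; exists r.
by rewrite big_seq1 mul1r.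
Qed.

Lemma polarized_ideal_least (V : set B) : subspace V ->
  (forall i f, V f -> V ('X_i * f)) -> (forall r, r \in a -> V (polarize d r)) ->
  forall g, g \in J -> V g.
Proof.
move=> sV VX Va g /ideal_genP[s sa ->]; rewrite big_seq.
apply: subspace_sum => // u /sa[r ra <-].
by apply: mpoly_mul_closed => //; exact: Va.
Qed.

(** The elements with all coefficients in [a] form an ideal: the correction
    term in the action of [y] stays in [a], as [a] is homogeneous in [y]. *)
Lemma coef_mem i g : g \in J -> c i g \in a.
Proof.
move=> gJ; suff : forall i, c i g \in a by apply.
move: g gJ; apply: (@polarized_ideal_least [set g | forall i, c i g \in a]) => [|b f fa|r ra].
- split=> [j|e u v ua va j]; first by rewrite linear0 rpred0.
  by rewrite linearP; apply: rpredD (va j); exact: ideal_scale (ua j).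
- have ya l := ideal_mull 'X_y (fa l); have da l := ydeg_ideal d.-1 (fa l).
  elim/var_cases: b => [j jy||] l.
  + by rewrite coefMX //; exact: ideal_mull (fa l).
  + case: l => [|l]; last by rewrite coefMy; exact: rpredD (ya _) (da _).
    by rewrite [c 0 _](ell_quotMy d_gt0 f).1; exact: ya 0%N.
  + case: l => [|l]; first by rewrite (coefMz d_gt0 f).1; exact: ya.
    by rewrite (coefMz d_gt0 f).2; apply: rpredD (ya _) _; exact: rpredB (da _) (fa _).
- case=> [|j]; last by rewrite coef_polarize rpred0.
  by rewrite /coef /= depolarize_polarize.
Qed.

(** [g] is the finite sum of the [ell^i * polarize d (c i g)]. *)
Lemma mem_coef t g : g \is t.-homog -> (forall i, (i <= t)%N -> c i g \in a) -> g \in J.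
Proof.
elim: t g => [|t IH] g gt ga; rewrite (ell_quotE d_gt0 g).
  by rewrite ell_quot_homog0 // mulr0 addr0 polarize_mem //; exact: (ga 0%N).
apply: rpredD; first by apply: polarize_mem; exact: (ga 0%N).
apply: ideal_mull; apply: IH; first exact: ell_quot_homog.
by move=> i it; rewrite -coefS; exact: ga.
Qed.

Lemma homogeneous_polarized : homogeneous (@std_grading k n.+2) J.
Proof.
have pJ t g : g \in J -> pihomog mdeg t g \in J.
  move=> gJ; suff : forall t, pihomog mdeg t g \in J by apply.
  move: g gJ; apply: (@polarized_ideal_least [set g | forall t, pihomog mdeg t g \in J]).
  - split=> [s|e u v uJ vJ s]; first by rewrite linear0 rpred0.
    by rewrite linearP; apply: rpredD (vJ s); exact: ideal_scale (uJ s).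
  - move=> i f fJ [|s]; first by rewrite pihomogMX0 /= ?mdeg1 // rpred0.
    have := pihomogMX mdeg i f s; rewrite /= mdeg1 addn1 => ->; exact: ideal_mull (fJ s).
  - move=> r ra s; rewrite pihomog_polarize //.
    exact: polarize_mem (homog_ideal homogeneous_std s ra).
move=> g gJ; exists [seq pihomog mdeg t g | t <- iota 0 (msize g)].
  rewrite big_map {1}(pihomog_partitionE (mf := mdeg) (leqnn (msize g))).
  by rewrite -(big_mkord xpredT (fun t => pihomog mdeg t g)) /index_iota subn0.
move=> _ /mapP[t _ ->]; exists t; split; first exact: pJ.
exact: pihomogP.
Qed.

Local Notation R := (quotalg a).
Local Notation P := (quotalg J).

Definition qcoef i : {linear P -> R} := induced (@coef_mem i).
Definition qydeg j : {linear R -> R} := induced (@ydeg_ideal j).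
(** The correction for [z = y - ell]. *)
Definition qydeg_minus_id : {linear R -> R} := qydeg d.-1 \- idfun.
Definition var_ydeg (i : 'I_n.+1) : nat := (i == y).

Lemma qcoefE i f : qcoef i (qproj J f) = qproj a (c i f).
Proof. exact: inducedE. Qed.

Lemma qydegE j f : qydeg j (qproj a f) = qproj a (pihomog ydeg j f).
Proof. exact: inducedE. Qed.

Lemma qydeg_gr t j v : quot_grading t v -> quot_grading t (qydeg j v).
Proof.
move=> [f ft <-]; rewrite [qydeg j _]qydegE; exists (pihomog ydeg j f) => //.
rewrite /std_grading /= pihomogE big_seq_cond; apply: rpred_sum => m /andP[mf _].
by apply: rpredZ; rewrite dhomogX /= (dhomog_mf ft mf).
Qed.

Lemma qydeg_sep t : separated qydeg (@quot_grading k n.+1 a t) t.+1.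
Proof.
move=> _ [f ft <-] f0.
have ft' : (mmeasure ydeg f <= t.+1)%N.
  rewrite mmeasureE; apply/bigmax_leqP_seq => m mf _; rewrite ltnS -(dhomog_mf ft mf).
  by rewrite /= /ydeg mdegE (bigD1 y) //= leq_addr.
rewrite (pihomog_partitionE ft') -/(qproj a _) linear_sum big1 // => j _.
exact: etrans (esym (qydegE j f)) (f0 j (ltn_ord j)).
Qed.

Lemma qydeg_orth i j v : qydeg i (qydeg j v) = if i == j then qydeg j v else 0.
Proof.
elim/qproj_ind: v => f; rewrite !qydegE.
case: eqVneq => [->|ij]; first by rewrite pihomog_id.
by rewrite (pihomog_ne0 _ (pihomogP ydeg j f)) ?linear0 // eq_sym.
Qed.

Lemma ydeg_var i : ydeg U_(i)%MM = var_ydeg i.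
Proof. by rewrite /ydeg mnm1E. Qed.

Lemma qydeg_mulvar i j v : qydeg (j + var_ydeg i)%N (mulvar i v) = mulvar i (qydeg j v).
Proof.
elim/qproj_ind: v => f; rewrite mulvarE !qydegE mulvarE.
by have := pihomogMX ydeg i f j; rewrite /= ydeg_var => ->.
Qed.

Lemma qydeg_mulvar0 i j v : (j < var_ydeg i)%N -> qydeg j (mulvar i v) = 0.
Proof.
elim/qproj_ind: v => f ji; rewrite mulvarE qydegE pihomogMX0 ?linear0 //=.
by rewrite ydeg_var.
Qed.

Section Lift.
Variable L : nat -> nat -> set R.
Hypothesis segL : segments (@mulvar k n.+1 a) (@quot_grading k n.+1 a) L.
Hypothesis L_ydeg : forall t h j v, (h <= dim (@quot_grading k n.+1 a t))%N ->
  L t h v -> L t h (qydeg j v).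

Local Notation acts := (acts (@mulvar k n.+1 a) (@mulvar k n.+2 J) qcoef).

Lemma acts_x i : i != y -> acts (wid i) i \0.
Proof.
move=> iy; elim/qproj_ind=> f; rewrite /= mulvarE; split=> [|l]; rewrite /= !qcoefE coefMX //.
  by rewrite mulvarE.
by rewrite mulvarE addr0.
Qed.

Lemma acts_y : acts (wid y) y (qydeg d.-1).
Proof.
elim/qproj_ind=> f; rewrite /= mulvarE; split=> [|l]; rewrite /= !qcoefE mulvarE.
  by rewrite [c 0 _](ell_quotMy d_gt0 f).1.
by rewrite coefMy linearD qydegE.
Qed.

Lemma acts_z : acts z y qydeg_minus_id.
Proof.
elim/qproj_ind=> f; rewrite /= mulvarE; split=> [|l]; rewrite /= !qcoefE mulvarE.
  by rewrite (coefMz d_gt0 f).1.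
by rewrite (coefMz d_gt0 f).2 linearD linearB /= qydegE.
Qed.

Lemma segments_polarized : exists L', segments (@mulvar k n.+2 J) (@quot_grading k n.+2 J) L'.
Proof.
eexists; apply: (segments_lifted (c := qcoef) _ (findim_gr a) _ segL (findim_gr J)).
- exact: mulvarC.
- exact: (mulvar_gr homogeneous_std).
- exact: (mulvar_gr homogeneous_polarized).
- move=> t _ i [f ft <-] it; rewrite [qcoef _ _]qcoefE; exists (c i f) => //.
  exact: coef_homog.
- by move=> t _ i [f ft <-] ti; rewrite [LHS]qcoefE (coef_out d_gt0 ft ti) linear0.
- move=> t _ [f ft <-] f0; apply/qproj_eq0/(mem_coef ft) => i it.
  by apply/qproj_eq0; rewrite -qcoefE; exact: f0.
- move=> t u hu.
  have /choice[w wP] : forall i, exists f : A, (i <= t)%N ->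
      f \is (t - i).-homog /\ qproj a f = u i.
    move=> i; case: (leqP i t) => it; last by exists 0.
    by have [f ft fu] := hu i it; exists f.
  have [i it|f ft fu] := @coef_surj k n d d_gt0 t w; first by case: (wP i it).
  exists (qproj J f); first by exists f.
  by move=> i it; rewrite qcoefE fu //; case: (wP i it).
- elim/var_cases=> [i iy||].
  + exists i, \0; first exact: acts_x.
    by move=> t h ht v _; apply: subspace0; apply: findim_subspace; exact: (findim_segment segL).
  + exists y, (qydeg d.-1); first exact: acts_y.
    by move=> t h ht v; exact: L_ydeg.
  + exists y, qydeg_minus_id; first exact: acts_z.
    move=> t h ht v Lv; apply: subspaceB => //; last exact: L_ydeg.
    by apply: findim_subspace; exact: (findim_segment segL).
- move=> i; have [->|iy] := eqVneq i y; first by exists (wid y), (qydeg d.-1); exact: acts_y.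
  by exists (wid i), \0; exact: acts_x.
- exists (wid y), z; elim/qproj_ind=> f; rewrite /= !mulvarE -linearB -mulrBl -/(ell k n).
  by split=> [|i]; rewrite !qcoefE ?(coefMell d_gt0 f).1 ?(coefMell d_gt0 f).2 ?linear0.
Qed.

End Lift.
End PolarizedQuotient.

Theorem theorem3p23 (k : fieldType) (n : nat) (a : ideal {mpoly k[n.+1]})
    (d : nat)
    (ha : homogeneous (@bigrading k n) a)
    (ha1 : component (@std_grading k n.+1) a 1%N = [set 0])
    (hd : (1 <= d)%N) :
  quot_admits_embedding a ->
  quot_admits_embedding (polarized_ideal d a).
Proof.
move=> [eps eps_embedding].
have hstd := homogeneous_std ha.
have segE := segments_of_embedding hstd eps_embedding.
have deltaG t j v : quot_grading t v -> quot_grading t (qydeg ha j v).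
  exact: qydeg_gr.
(* Initial spaces for the degree in y, to make the segments stable under the
   corrections by which y and z act. *)
have segL := segments_leading (findim_gr a) (mulvar_gr hstd) segE deltaG
  (@qydeg_sep _ _ _ ha) (qydeg_orth ha) (qydeg_mulvar ha) (qydeg_mulvar0 ha).
have [|L' segL'] := segments_polarized (ha := ha) hd segL.
  move=> t h j v ht; apply: (leading_delta deltaG (qydeg_orth ha)).
  by apply: findim_subspace; exact: (findim_segment segE).
exact: embedding_of_segments (homogeneous_polarized ha hd) _ segL'.
Qed.
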